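(* Let $\Delta$ be the open unit disc in $\mathbb{C}$ and let $K$ be a compact subset of $\Delta$. Suppose that $K$ has empty interior in $\mathbb{C}$, that $\mathbb{C}\setminus K$ is connected, and that $K$ contains at least one closed line segment. Let $X$ be a Swiss cheese set with $K\subseteq X$ such that (i) every point of $X\setminus K$ is both a point of continuity and an R-point for $R(X)$; and (ii) for every closed line segment $J$ contained in $K$, every $f\in R(X)$ is infinitely differentiable on $J$ and satisfies $\sum_{k=1}^\infty |f^{(k)}|_J^{-1/k}=\infty$. Let $I$ be a closed line segment contained in $K$. Then $R(X)$ has no non-trivial Jensen measures, but no point of $I$ is an R-point or a point of continuity for $R(X)$, and so $R(X)$ is not regular.
   Context: A compact plane set is a non-empty compact subset of $\mathbb{C}$. A Swiss cheese set is a compact plane set obtained by deleting a sequence of open discs from a closed disc. For a compact plane set $X$, $C(X)$ denotes the algebra of all continuous functions $X\to\mathbb{C}$, and $R(X)$ denotes the set of all $f\in C(X)$ which can be uniformly approximated on $X$ by rational functions with no poles on $X$. With the uniform norm, $R(X)$ is a uniform algebra which is natural on $X$: its only characters are the evaluations at points of $X$, and points of $X$ are identified with these characters. For $x\in X$, let $J_x$ be the ideal of all $f\in R(X)$ such that $x$ lies in the interior (relative to $X$) of the zero set $f^{-1}(\{0\})$, and let $M_x=\{f\in R(X): f(x)=0\}$. A point $x\in X$ is a point of continuity for $R(X)$ if for all $y\in X\setminus\{x\}$ we have $J_y\not\subseteq M_x$. A point $x\in X$ is an R-point for $R(X)$ if for all $y\in X\setminus\{x\}$ we have $J_x\not\subseteq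 M_y$. $R(X)$ is regular if for every closed $F\subseteq X$ and every $y\in X\setminus F$ there is $f\in R(X)$ with $f(y)=1$ and $f(F)\subseteq\{0\}$. A representing measure for $x\in X$ (with respect to $R(X)$) is a regular Borel probability measure $\mu$ on $X$ with $f(x)=\int_X f\,d\mu$ for all $f\in R(X)$. A Jensen measure for $x$ is a representing measure $\mu$ for $x$ such that $\log|f(x)|\le\int_X\log|f(w)|\,d\mu(w)$ for all $f\in R(X)$, where $\log(0):=-\infty$. Such a measure is trivial if it is the point mass at $x$. ''$R(X)$ has no non-trivial Jensen measures'' means that, for every $x\in X$, every Jensen measure for $x$ is trivial. All line segments are non-degenerate line segments in $\mathbb{C}$. Derivatives of a function $f$ on a line segment $J$ are limits of difference quotients using points of $J$ only, $f^{(k)}$ denotes the $k$-th such derivative, and $|g|_J=\sup_{z\in J}|g(z)|$. The convention $1/0=\infty$ is used, so the sum in (ii) is $\infty$ if some $f^{(k)}$ ($k\ge1$) vanishes identically on $J$. *)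

(* Defs.v *)
From HB Require Import structures.
From mathcomp Require Import all_boot all_order all_algebra.
From mathcomp Require Import complex.
From mathcomp Require Import all_classical all_reals all_analysis.

Set Implicit Arguments.
Unset Strict Implicit.
Unset Printing Implicit Defensive.

Import Order.TTheory GRing.Theory Num.Theory Normc.
Import numFieldNormedType.Exports.

Local Open Scope classical_set_scope.
Local Open Scope ring_scope.
Local Open Scope complex_scope.

(* The library gives [R[i]] its field structure but no topology; it is a normed
   module over itself, with the topology induced by the modulus. *)
HB.instance Definition _ (R : realType) := NormedModule.copy R[i] R[i]^o.

(* The complex plane with its Borel sigma-algebra. *)
Notation borelC R := (g_sigma_algebraType (@open R[i])).

Section RationalApproximation.
Context {R : realType}.
Implicit Types (X K J F : set R[i]) (x y z w : R[i]) (f g : R[i] -> R[i]).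

Definition open_disc x (r : R) : set R[i] := [set z | normc (z - x) < r].

Definition closed_disc x (r : R) : set R[i] := [set z | normc (z - x) <= r].

Definition compact_plane_set X : Prop := X !=set0 /\ compact X.

(* Finitely many deleted discs are covered: discs may repeat or miss the closed
   disc. *)
Definition swiss_cheese_set X : Prop :=
  compact_plane_set X /\
  exists (a : R[i]) (r : R) (b : nat -> R[i]) (s : nat -> R),
    [/\ 0 < r, forall n, 0 < s n &
        X = closed_disc a r `\` \bigcup_n open_disc (b n) (s n)].

(* Elements of [C(X)] and [R(X)] are represented by functions on the whole plane
   whose values outside [X] are irrelevant. *)
Definition C_ X : set (R[i] -> R[i]) := [set f | {within X, continuous f}].

Definition R_ X : set (R[i] -> R[i]) :=
  [set f | C_ X f /\
    forall e : R, 0 < e -> exists p q : {poly R[i]},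
      forall z, X z -> q.[z] != 0 /\ normc (f z - p.[z] / q.[z]) < e].

Definition J_ X x : set (R[i] -> R[i]) :=
  [set f | R_ X f /\ within X (nbhs x) (f @^-1` [set 0])].

Definition M_ X x : set (R[i] -> R[i]) := [set f | R_ X f /\ f x = 0].

Definition point_of_continuity X x : Prop :=
  X x /\ forall y, X y -> y <> x -> ~ (J_ X y `<=` M_ X x).

Definition R_point X x : Prop :=
  X x /\ forall y, X y -> y <> x -> ~ (J_ X x `<=` M_ X y).

(* [X] being compact, its relatively closed subsets are closed in the plane. *)
Definition regular_R X : Prop :=
  forall F y, closed F -> F `<=` X -> (X `\` F) y ->
    exists f, [/\ R_ X f, f y = 1 & f @` F `<=` [set 0]].

Definition regular_measure (mu : {measure set (borelC R) -> \bar R}) : Prop :=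
  forall A : set (borelC R), measurable A ->
    mu A = ereal_inf [set mu U | U in [set U : set R[i] | open U /\ A `<=` U]] /\
    mu A = ereal_sup [set mu L | L in [set L : set R[i] | compact L /\ L `<=` A]].

(* A Borel probability measure on [X] is represented by one on the plane that is
   carried by [X]. *)
Definition representing_measure X x (mu : probability (borelC R) R) : Prop :=
  [/\ mu X = 1%E, regular_measure mu &
      forall f, R_ X f ->
        f x = (\int[mu]_(z in X) complex.Re (f z))%R
           +i* (\int[mu]_(z in X) complex.Im (f z))%R].

Definition Jensen_measure X x (mu : probability (borelC R) R) : Prop :=
  representing_measure X x mu /\
  forall f, R_ X f ->
    (lne (normc (f x))%:E <= \int[mu]_(w in X) lne (normc (f w))%:E)%E.

Definition trivial_measure x (mu : probability (borelC R) R) : Prop :=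
  forall A : set (borelC R), measurable A -> mu A = \d_(x : borelC R) A.

Definition no_nontrivial_Jensen_measures X : Prop :=
  forall x mu, X x -> Jensen_measure X x mu -> trivial_measure x mu.

Definition line_segment J : Prop :=
  exists a b : R[i], a <> b /\
    J = [set (a + t%:C * (b - a)) | t in [set t : R | 0 <= t <= 1]].

Definition diff_quot f z w : R[i] := (f w - f z) / (w - z).

Definition differentiable_on J f : Prop :=
  forall z, J z -> cvg (diff_quot f z w @[w --> within J z^']).

Definition derive_on J f : R[i] -> R[i] :=
  fun z => lim (diff_quot f z w @[w --> within J z^']).

Definition derive_onn J (k : nat) f : R[i] -> R[i] := iter k (derive_on J) f.

Definition infinitely_differentiable_on J f : Prop :=
  forall k, differentiable_on J (derive_onn J k f).

Definition sup_norm_on J g : \bar R := ereal_sup [set (normc (g z))%:E | z in J].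

(* The root is taken inside the extended-real inverse, because [0^-1 = +oo]
   there, whereas [poweR 0 r = 0] for every negative [r]. *)
Definition quasianalytic_sum J f : \bar R :=
  (\sum_(1 <= k <oo) (poweR (sup_norm_on J (derive_onn J k f)) k%:R^-1)^-1)%E.

End RationalApproximation.

(* Main.v *)
Require Import Defs.
From mathcomp Require Import all_boot all_order all_algebra.
From mathcomp Require Import complex finmap ring lra.
From mathcomp Require Import all_classical all_reals all_analysis.
From mathcomp Require Import measurable_realfun.
Import Order.TTheory GRing.Theory Num.Theory Normc.
Import numFieldNormedType.Exports.
Local Open Scope classical_set_scope.
Local Open Scope ring_scope.
Local Open Scope complex_scope.
Set Implicit Arguments.
Unset Strict Implicit.
Unset Printing Implicit Defensive.

(** Two independent arguments are combined.

    On the segment I.  Let f in R(X) vanish near a point x of I and let y be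
    another point of I.  All derivatives of f along the segment from x to y
    vanish at x, and the hypothesis on this very segment is Carleman's
    condition, so the Denjoy-Carleman theorem gives f(y) = 0
    ([quasianalytic_unique_continuation]).  Hence J_x is contained in M_y for
    all distinct x, y in I ([J_sub_M_segment]).  Read at x this says that x is
    not an R-point, read at y that y is not a point of continuity, and it
    contradicts the separation of y from a neighbourhood of x that regularity
    would provide.

    The Denjoy-Carleman theorem is proved here for M_k = sup |F^(k)|, without
    assuming that M is logarithmically convex, by a descent due to Bang.  For
    n > 0 let q be the largest (M_n / M_m)^(1/(n-m)) with m < n.  The estimate
    |F^(j)| <= M_n / (e q)^(n-j) for j < n at a point extends, over a length
    (n - m) / (e q), with the loss of a factor e^(n-m) only
    ([taylor_growth]), which turns it into the estimate of the same kind
    for m.  At the flat point the estimate is trivial for every n; going down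
    from a large N to 0 one passes through the vertices of the Newton polygon
    of log M, and the total length covered is a sum of numbers a_i / e with
    M_0 / M_k <= a_0 ... a_(k-1) ([bang_chain]).  Carleman's inequality bounds
    the sum of the (M_0 / M_k)^(1/k) by e times the sum of the a_i, so the
    divergence hypothesis makes this length exceed that of the segment, and
    then |F| <= M_0 / e everywhere, which forces M_0 = 0.

    Jensen measures.  Let mu be a Jensen measure for x.  If some f in J_y has
    f(x) <> 0, then log|f| is -oo near y but has an integral bounded below, so
    mu has no mass near y ([Jensen_support]).  When x lies outside K this
    applies to every y other than x, because x is a point of continuity.  When
    x lies in K it applies to every y in X outside K, because y is an R-point,
    and so mu is carried by K.  It remains to see that mu is trivial in this
    second case ([Jensen_thin]).  For zeta outside K, Runge's theorem makes
    1 / (z - zeta) a uniform limit of polynomials on K, so Jensen's inequality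
    can be applied to it: the integral of log(|w - zeta| / r), with
    r = |zeta - x|, is not positive.  A mass m at distance at least rho from x
    contributes about m log(rho / r) to this integral, whereas the points w
    close to zeta contribute negatively.  Averaging over the radius produces r
    of any prescribed small size for which the negative part is bounded by
    an absolute constant ([select_radius]); and K having no interior
    and a connected complement, the circle of radius r about x does meet the
    complement of K.  As r tends to 0 this leaves only m = 0. *)

(** * Mean value inequality on an interval *)

Section MeanValue.
Variable R : realType.
Implicit Types (a b t s : R) (F D : R -> R[i]) (z w : R[i]).

Lemma normc_ge0 z : 0 <= normc z.
Proof. by case: z => a b; exact: sqrtr_ge0. Qed.

Lemma normcR (x : R) : normc x%:C = `|x|.
Proof. by rewrite /normc /= expr0n /= addr0 sqrtr_sqr. Qed.

Lemma Re_le_normc z : `|complex.Re z| <= normc z.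
Proof. by rewrite -lecR; exact: normc_ge_Re. Qed.

Lemma normc_eq0 z : (normc z == 0) = (z == 0).
Proof. by apply/eqP/eqP => [/eq0_normc//|->]; exact: normc0. Qed.

Lemma normc_gt0 z : (0 < normc z) = (z != 0).
Proof. by rewrite lt_neqAle eq_sym normc_eq0 normc_ge0 andbT. Qed.

Lemma normcB_gt0 z w : (0 < normc (z - w)) = (z != w).
Proof. by rewrite normc_gt0 subr_eq0. Qed.

Lemma normc_distC z w : normc (z - w) = normc (w - z).
Proof. by rewrite -normcN opprB. Qed.

(** An explicit form of: F is differentiable on the interval with derivative D,
    one-sided at the end points.  It is insensitive to the values of F outside
    the interval, and it restricts to subintervals. *)
Definition has_deriv_on a b F D := forall t, a <= t <= b ->
  forall e : R, 0 < e -> exists2 d : R, 0 < d & forall s, a <= s <= b ->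
  `|s - t| < d -> normc (F s - F t - (s - t)%:C * D t) <= e * `|s - t|.

Lemma is_derive_eps (h : R -> R) (x l : R) :
  (forall e : R, 0 < e -> exists2 d : R, 0 < d & forall s, `|s - x| < d ->
     `|h s - h x - (s - x) * l| <= e * `|s - x|) ->
  is_derive x 1 h l.
Proof.
move=> hl.
have H : (fun t => t^-1 *: ((h \o shift x) (t *: (1:R)) - h x)) @ 0^' --> l.
  apply/cvgrPdist_le => e e0; have [d d0 hd] := hl e e0.
  apply/nbhs_normP; exists d => //= t /= td t0.
  move: td; rewrite sub0r normrN => td; have := hd (t + x).
  rewrite addrK => /(_ td) ht; rewrite /= /GRing.scale /= mulr1.
  rewrite -[l](mulKf t0) -mulrBr normrM normfV mulrC ler_pdivrMr ?normr_gt0//.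
  by rewrite distrC.
by split; [apply/cvg_ex; exists l | exact: cvg_lim].
Qed.

Lemma is_derive_affine (c x t : R) : is_derive t 1 (fun s : R => c * (s - x)) c.
Proof.
apply: is_derive_eps => e e0; exists 1 => // s _.
rewrite (_ : _ - _ - _ = 0); last by ring.
by rewrite normr0 mulr_ge0// ltW.
Qed.

(** The complex inequality follows from the real mean value theorem applied to
    phi - Re (v F), where v is the unit number that makes v (F t - F a)
    a nonnegative real. *)
Lemma growth_bound a b F D (phi dphi : R -> R) :
  has_deriv_on a b F D ->
  (forall t, a <= t <= b -> is_derive t 1 phi (dphi t)) ->
  (forall t, a <= t <= b -> normc (D t) <= dphi t) ->
  forall t, a <= t <= b -> normc (F t - F a) <= phi t - phi a.
Proof.
move=> dF dp hD t /andP[at_ tb].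
(* When F t = F a this is 0, since division by 0 yields 0; no case split is needed. *)
pose v : R[i] := (normc (F t - F a))%:C / (F t - F a).
have v1 : normc v <= 1.
  rewrite normcM normcV normcR (ger0_norm (normc_ge0 _)).
  by have [->|n0] := eqVneq (normc (F t - F a)) 0; rewrite ?mul0r ?divff.
have vF : v * (F t - F a) = (normc (F t - F a))%:C.
  have [z0|n0] := eqVneq (F t - F a) 0; last by rewrite divfK.
  by rewrite z0 mulr0 normc0.
pose h s := complex.Re (v * F s).
have [eat|nat] := eqVneq a t; first by rewrite -eat !subrr normc0.
have {nat}at_ : a < t by rewrite lt_neqAle nat.
have sub s : a <= s <= t -> a <= s <= b by move=> /andP[-> /le_trans->].
have hs s : a <= s <= t -> forall e : R, 0 < e -> exists2 d : R, 0 < d &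
    forall s', a <= s' <= t -> `|s' - s| < d ->
    `|h s' - h s - (s' - s) * complex.Re (v * D s)| <= e * `|s' - s|.
  move=> /sub sab e e0; have [d d0 hd] := dF _ sab _ e0.
  exists d => // s' /sub s'ab /(hd _ s'ab) {}hd.
  have -> : h s' - h s - (s' - s) * complex.Re (v * D s) =
     complex.Re (v * (F s' - F s - (s' - s)%:C * D s)).
    by rewrite /h; move: (v) (F s') (F s) (D s) => [? ?] [? ?] [? ?] [? ?] /=; ring.
  apply: le_trans (Re_le_normc _) _; rewrite normcM.
  by apply: le_trans hd; rewrite ler_piMl ?normc_ge0.
have dh s : s \in `]a, t[ -> is_derive s 1 h (complex.Re (v * D s)).
  rewrite in_itv /= => /andP[as_ st]; apply: is_derive_eps => e e0.
  have sat : a <= s <= t by rewrite !ltW.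
  have [d d0 hd] := hs _ sat e e0.
  exists (Num.min d (Num.min (s - a) (t - s))).
    by rewrite !lt_min d0 !subr_gt0 as_ st.
  move=> s'; rewrite !lt_min => /and3P[s'd]; rewrite !ltr_norml => s'1 s'2.
  by apply: hd => //; lra.
have dph s : s \in `]a, t[ ->
    is_derive s 1 (phi - h) (dphi s - complex.Re (v * D s)).
  move=> sat; apply: is_deriveB; last exact: dh.
  by apply/dp/sub; move: sat; rewrite in_itv /= => /andP[/ltW-> /ltW->].
have cph : {within `[a, t], continuous (phi - h)}.
  apply/subspace_continuousP => s; rewrite /= in_itv /= => sat; apply: cvgB.
    apply: cvg_within_filter; apply/differentiable_continuous/derivable1_diffP.
    by have [] := dp _ (sub _ sat).
  apply/cvgrPdist_le => e e0; have [d d0 hd] := hs _ sat _ ltr01.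
  set l := complex.Re (v * D s) in hd.
  have l0 : 0 < 1 + `|l| by rewrite ltr_pwDl.
  apply/nbhs_normP; exists (Num.min d (e / (1 + `|l|))).
    by rewrite /= lt_min d0 divr_gt0.
  move=> s' /=; rewrite distrC lt_min => /andP[s'd s'e]; rewrite in_itv /= => s'at.
  have {}hd := hd _ s'at s'd; rewrite distrC.
  rewrite ltr_pdivlMr // in s'e.
  have -> : h s' - h s = (h s' - h s - (s' - s) * l) + (s' - s) * l by ring.
  apply: le_trans (ler_normD _ _) _; rewrite normrM; lra.
have [c cat] := MVT at_ dph cph.
have {}cat : a <= c <= t by move: cat; rewrite in_itv /= => /andP[/ltW-> /ltW->].
have dc : 0 <= dphi c - complex.Re (v * D c).
  rewrite subr_ge0; apply: le_trans (hD _ (sub _ cat)).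
  apply: le_trans (ler_norm _) _; apply: le_trans (Re_le_normc _) _.
  by rewrite normcM ler_piMl ?normc_ge0.
move=> E; have : 0 <= (phi - h) t - (phi - h) a.
  by rewrite E mulr_ge0 // subr_ge0 ltW.
have -> : (phi - h) t - (phi - h) a = phi t - phi a - complex.Re (v * (F t - F a)).
  rewrite mulrBr /h /= -[(phi - _) t]/(phi t - complex.Re (v * F t)).
  rewrite -[(phi - _) a]/(phi a - complex.Re (v * F a)).
  by move: (v * F t) (v * F a) => [? ?] [? ?] /=; ring.
by rewrite vF /= subr_ge0.
Qed.
End MeanValue.

(** * Carleman's inequality *)

Section Carleman.
Variable R : realType.
Implicit Types (a r : nat -> R).

Let e : R := expR 1.

Lemma expn_le_expR_fact (k : nat) : (k.+1%:R ^+ k : R) <= e ^+ k * k`!%:R.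
Proof.
elim: k => [|k IH]; first by rewrite !expr0 mul1r.
have step : (k.+2%:R ^+ k.+1 : R) <= e * k.+1%:R ^+ k.+1.
  have k0 : (0:R) < k.+1%:R by [].
  rewrite -ler_pdivrMr ?exprn_gt0// -expr_div_n.
  have -> : (k.+2%:R / k.+1%:R : R) = 1 + k.+1%:R^-1.
    by rewrite -natr1 mulrDl divff ?mul1r// lt0r_neq0.
  have -> : e = expR (k.+1%:R^-1) ^+ k.+1.
    by rewrite -expRM_natl mulfV// lt0r_neq0.
  rewrite lerXn2r ?nnegrE ?expR_ge0 ?addr_ge0 ?invr_ge0//.
  exact: expR_ge1Dx.
apply: le_trans step _; rewrite exprS [X in _ <= X](_ : _ =
   e * (k.+1%:R * (e ^+ k * k`!%:R))).
  by rewrite ler_pM2l ?expR_gt0// ler_pM2l.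
by rewrite factS natrM exprS; ring.
Qed.

Let s a k := \sum_(i < k) i.+1%:R * a i.

(** 1 / ((k+1)(k+2)) = 1/(k+1) - 1/(k+2), summed by parts; the weights of the
    means used below are chosen so that every a_i ends up with coefficient 1. *)
Lemma sum_telescope_mean a (N : nat) :
  \sum_(k < N) s a k.+1 / (k.+1%:R * k.+2%:R) =
  \sum_(i < N) a i - s a N / N.+1%:R.
Proof.
elim: N => [|N IH]; first by rewrite /s !big_ord0 mul0r subr0.
rewrite !big_ord_recr /= IH {IH} /s big_ord_recr /= -/(s a N).
by field; apply/andP; split; rewrite ?nat1r -?natrD pnatr_eq0.
Qed.

(** The arithmetic-geometric inequality is applied to the numbers (i+1) a_i
    instead of the a_i; the factorial that appears is controlled by
    (k+1)^k <= e^k k!. *)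
Lemma root_prod_le_mean a (x : R) (k : nat) : (forall i, 0 <= a i) -> 0 <= x ->
  x ^+ k.+1 <= \prod_(i < k.+1) a i -> x <= e * (s a k.+1 / (k.+1%:R * k.+2%:R)).
Proof.
move=> a0 x0 xa.
have s0 : 0 <= s a k.+1 by apply: sumr_ge0 => i _; exact: mulr_ge0.
have := @leif_AGM R 'I_k.+1 predT (fun i => i.+1%:R * a i) _.
rewrite card_ord => /(_ (fun i _ => mulr_ge0 (ler0n _ _) (a0 i))) [+ _].
rewrite big_split /= -[X in X / _]/(s a k.+1).
have -> : \prod_(i < k.+1) (i.+1%:R : R) = (k.+1)`!%:R.
  by rewrite fact_prod natr_prod big_add1 /= big_mkord.
move=> AG; have sk : 0 <= s a k.+1 / k.+1%:R by rewrite divr_ge0.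
have H : (x * k.+2%:R) ^+ k.+1 <= (e * (s a k.+1 / k.+1%:R)) ^+ k.+1.
  rewrite exprMn [leRHS]exprMn.
  apply: le_trans (_ : e ^+ k.+1 * ((k.+1)`!%:R * x ^+ k.+1) <= _).
    by rewrite mulrC mulrA ler_wpM2r ?exprn_ge0// expn_le_expR_fact.
  rewrite ler_pM2l ?exprn_gt0 ?expR_gt0//.
  by apply: le_trans AG; rewrite ler_wpM2l.
move: H; rewrite ler_pXn2r ?nnegrE ?mulr_ge0 ?expR_ge0// => H.
rewrite -ler_pdivlMr// in H; apply: le_trans H _.
by rewrite invfM !mulrA.
Qed.

(** Stated for any numbers r_k below the geometric means, so that no real
    powers are involved. *)
Lemma Carleman_inequality a r (N : nat) : (forall i, 0 <= a i) ->
  (forall k, 0 <= r k) -> (forall k, (k < N)%N -> r k.+1 ^+ k.+1 <= \prod_(i < k.+1) a i) ->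
  \sum_(k < N) r k.+1 <= e * \sum_(i < N) a i.
Proof.
move=> a0 r0 ra; apply: le_trans (_ : \sum_(k < N) e * (s a k.+1 / (k.+1%:R * k.+2%:R)) <= _).
  by apply: ler_sum => k _; exact: root_prod_le_mean (ra _ _).
rewrite -mulr_sumr sum_telescope_mean ler_pM2l ?expR_gt0// gerBl divr_ge0//.
by apply: sumr_ge0 => i _; exact: mulr_ge0.
Qed.
End Carleman.

(** * The Denjoy-Carleman theorem *)

Section Bang.
Variable R : realType.
Variables (T : R) (F : nat -> R -> R[i]) (M : nat -> R).
Hypothesis T0 : 0 < T.
Hypothesis dF : forall k, has_deriv_on 0 T (F k) (F k.+1).
Hypothesis F0 : forall k, F k 0 = 0.
Hypothesis FM : forall k (t : R), 0 <= t <= T -> normc (F k t) <= M k.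

Let e : R := expR 1.

Lemma bound_ge0 k : 0 <= M k.
Proof.
apply: le_trans (FM k (_ : 0 <= 0 <= T)); first exact: normc_ge0.
by rewrite lexx ltW.
Qed.

Lemma has_deriv_onW (x b : R) k : 0 <= x -> b <= T -> has_deriv_on x b (F k) (F k.+1).
Proof.
move=> x0 bT t /andP[xt tb] eps eps0.
have [|d d0 hd] := @dF k t _ eps eps0; first by apply/andP; split; lra.
exists d => // s /andP[xs sb]; apply: hd; apply/andP; split; lra.
Qed.

(** Iterating the mean value inequality from the point where every F_k
    vanishes. *)
Lemma vanishing_bound k t : 0 <= t <= T -> normc (F 0 t) <= M k * T ^+ k.
Proof.
move=> tT; suff H j : (j <= k)%N -> forall t, 0 <= t <= T ->
    normc (F (k - j) t) <= M k * T ^+ j by have := H k (leqnn k) _ tT; rewrite subnn.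
elim: j => [|j IH] jk {tT}t tT; first by rewrite subn0 expr0 mulr1 FM.
have Mj : 0 <= M k * T ^+ j by rewrite mulr_ge0 ?bound_ge0// exprn_ge0// ltW.
have := @growth_bound R 0 T (F (k - j.+1)) (F (k - j.+1).+1)
  (fun s => M k * T ^+ j * (s - 0)) (fun=> M k * T ^+ j) (@dF _) _ _ t tT.
rewrite F0 !subr0 mulr0 !subr0 => H; apply: le_trans (H _ _) _.
- by move=> s _; exact: is_derive_affine.
- by move=> s sT; rewrite subnSK//; apply: IH => //; exact: ltnW.
- by rewrite exprSr mulrA ler_wpM2l//; case/andP: tT.
Qed.

(** By downward induction on j: the function M_n c^(j-n) e^(c(t-x)) is an
    antiderivative of its successor in j, so it dominates F_j as soon as it does
    so at x, and at j = n it dominates because F_n is bounded by M_n.  This does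
    the work of Taylor's formula of order n - j. *)
Lemma taylor_growth (n : nat) (c x b : R) : 0 < c -> 0 <= x -> b <= T ->
  (forall j, (j < n)%N -> normc (F j x) <= M n / c ^+ (n - j)) ->
  forall j t, (j <= n)%N -> x <= t <= b ->
  normc (F j t) <= M n / c ^+ (n - j) * expR (c * (t - x)).
Proof.
move=> c0 x0 bT Fx.
suff H i : (i <= n)%N -> forall t, x <= t <= b ->
    normc (F (n - i) t) <= M n / c ^+ i * expR (c * (t - x)).
  by move=> j t jn xtb; have := H (n - j)%N (leq_subr _ _) t xtb; rewrite subKn.
elim: i => [|i IH] ilen t xtb.
  rewrite subn0 expr0 divr1; apply: le_trans (FM _ _) _.
    by case/andP: xtb => *; apply/andP; split; lra.
  rewrite ler_peMr ?bound_ge0// -expR0 ler_expR mulr_ge0 ?(ltW c0)// subr_ge0.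
  by case/andP: xtb.
pose phi s := M n / c ^+ i.+1 * expR (c * (s - x)).
have cS : c ^+ i.+1 != 0 by rewrite lt0r_neq0// exprn_gt0.
have := @growth_bound R x b (F (n - i.+1)) (F (n - i.+1).+1)
  phi (fun s => M n / c ^+ i * expR (c * (s - x))) (has_deriv_onW _ x0 bT) _ _ t xtb.
move=> H; have {}H : normc (F (n - i.+1) t - F (n - i.+1) x) <= phi t - phi x.
  apply: H => s sxb; last by rewrite subnSK//; apply: IH => //; exact: ltnW.
  have de := @is_derive1_comp R expR (fun s => c * (s - x)) s _ _
    (is_derive_expR _) (is_derive_affine c x s).
  have := @is_deriveZ R R R _ (M n / c ^+ i.+1) s 1 _ de.
  congr is_derive; rewrite /GRing.scale /= exprS; field.
  by rewrite ?expf_neq0 lt0r_neq0.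
rewrite -[F _ t](subrK (F (n - i.+1) x)); apply: le_trans (le_normcD _ _) _.
rewrite -lerBrDr; apply: le_trans H _; rewrite lerD2l lerN2 /phi subrr mulr0 expR0 mulr1.
have := Fx (n - i.+1)%N; rewrite subKn//; apply.
by rewrite ltn_subrL/= (leq_ltn_trans _ ilen).
Qed.
End Bang.

(** Here log q is the largest slope of the lines that join the point
    (n, log M_n) to the earlier points of the graph of log M; it is the slope of
    the last edge of the lower convex hull of that graph up to n. *)
Lemma max_slope (R : realType) (M : nat -> R) (n : nat) : (forall k, 0 < M k) ->
  (0 < n)%N -> exists2 q : R, 0 < q &
  (exists2 k, (k < n)%N & M k * q ^+ (n - k) = M n) /\
  (forall k, (k < n)%N -> M n <= M k * q ^+ (n - k)).
Proof.
move=> M0 n0; pose f (k : 'I_n) := (M n / M k) `^ (n - k)%:R^-1.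
have fX k : f k ^+ (n - k) = M n / M k.
  rewrite /f -powR_mulrn ?powR_ge0// -powRrM mulVf ?powRr1 ?divr_ge0// ?ltW//.
  by rewrite pnatr_eq0 subn_eq0 -ltnNge.
have [k0 _ hk0] := @Order.TotalTheory.arg_maxP _ _ 'I_n (Ordinal n0) predT f isT.
exists (f k0); first by rewrite powR_gt0// divr_gt0.
split; first by exists k0 => //; rewrite fX mulrCA divff ?mulr1// lt0r_neq0.
move=> k kn; have := hk0 (Ordinal kn) isT => kk0.
rewrite mulrC -ler_pdivrMr// -(fX (Ordinal kn)) /=.
by rewrite lerXn2r ?nnegrE ?powR_ge0.
Qed.

Section BangChain.
Variable R : realType.
Variables (T : R) (F : nat -> R -> R[i]) (M : nat -> R).
Hypothesis T0 : 0 < T.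
Hypothesis dF : forall k, has_deriv_on 0 T (F k) (F k.+1).
Hypothesis FM : forall k (t : R), 0 <= t <= T -> normc (F k t) <= M k.
Hypothesis Mgt0 : forall k, 0 < M k.
Hypothesis MT : forall k, M 0 <= M k * T ^+ k.

Let e : R := expR 1.

(** The line of slope log q through (n, log M_n) takes the value
    log (M_n / q^(n-j)) at j; the bound is smaller by the factor e^(j-n). *)
Definition small_up_to (n : nat) (q E : R) := forall x : R, 0 <= x <= E -> x <= T ->
  forall j, (j < n)%N -> normc (F j x) <= M n / (e * q) ^+ (n - j).

(** A point of [0, E + h] is within h of a point where the estimates hold. *)
Lemma small_growth (n : nat) (q E h : R) : 0 < q -> 0 <= E -> 0 <= h -> small_up_to n q E ->
  forall t, 0 <= t <= E + h -> t <= T -> forall j, (j <= n)%N ->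
  normc (F j t) <= M n / (e * q) ^+ (n - j) * expR (e * q * h).
Proof.
move=> q0 E0 h0 S t /andP[t0 tE] tT j jn.
have c0 : 0 < e * q by rewrite mulr_gt0// expR_gt0.
have [x [x0 xE xt tx]] : exists x : R, [/\ 0 <= x, x <= E, x <= t & t - x <= h].
  have [tE'|Et] := leP t E; first by exists t; rewrite subrr.
  by exists E; split => //; lra.
have xT : x <= T by exact: le_trans tT.
have H := @taylor_growth R T F M T0 dF FM n (e * q) x T c0 x0 (lexx _) _ j t jn.
apply: le_trans (H _ _) _.
- by move=> i ilt; apply: S => //; rewrite x0 xE.
- by rewrite xt tT.
- rewrite ler_wpM2l//; first by rewrite divr_ge0// ?exprn_ge0// ltW.
  by rewrite ler_expR ler_pM2l.
Qed.

(** Induction along the vertices of the Newton polygon of log M.  Here q is the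
    slope of the edge that ends at n, and a_i is the inverse of the slope above
    [i, i+1]; so the products of the a_i are the inverses of the greatest
    log-convex minorant, normalized at 0, and they lie above M_0 / M_k with
    equality at vertices.  The first edge is not used up completely: stopping
    one unit before 0, which costs a_0, leaves the factor 1 / e on M_0. *)
Lemma bang_chain (n : nat) : (0 < n)%N -> exists q (a : nat -> R),
  [/\ 0 < q,
      (exists2 k, (k < n)%N & M k * q ^+ (n - k) = M n),
      (forall k, (k < n)%N -> M n <= M k * q ^+ (n - k)) &
  [/\ forall i, 0 < a i,
      forall k, (k <= n)%N -> M 0 <= M k * \prod_(i < k) a i,
      M 0 = M n * \prod_(i < n) a i,
      a 0 <= T &
      forall E, 0 <= E -> small_up_to n q E ->
        T <= E + (\sum_(i < n) a i - a 0) / e ->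
        forall t : R, 0 <= t <= T -> normc (F 0 t) <= M 0 / e]].
Proof.
elim/ltn_ind: n => n IH n0.
have [q q0 [[m mn Mm] qn]] := max_slope Mgt0 n0.
exists q; have c0 : 0 < e * q by rewrite mulr_gt0// expR_gt0.
have [m0|m0] := posnP m.
  rewrite m0 subn0 in Mm; exists (fun=> q^-1).
  have prodq k : \prod_(i < k) q^-1 = (q ^+ k)^-1 by rewrite prodr_const card_ord exprVn.
  split => //; first by exists 0%N => //; rewrite subn0.
  split.
  - by move=> i; rewrite invr_gt0.
  - move=> k; rewrite leq_eqVlt => /predU1P[->|kn].
      by rewrite prodq -Mm mulfK// expf_neq0// lt0r_neq0.
    rewrite prodq ler_pdivlMr ?exprn_gt0//.
    have := qn _ kn; rewrite -Mm -{1}(subnK (ltnW kn)) addnC exprD mulrA.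
    by rewrite ler_pM2r// exprn_gt0.
  - by rewrite prodq -Mm mulfK// expf_neq0// lt0r_neq0.
  - rewrite -div1r ler_pdivrMr//.
    have := MT n; rewrite -Mm -mulrA ler_pMr// -exprMn => H.
    by rewrite -(@ler_pXn2r _ n) ?nnegrE ?expr1n 1?mulrC// mulr_ge0// ltW.
  move=> E E0 S TE t tT.
  (* The remaining length n / (e q) is cut by 1 / (e q) = a_0 / e to keep a factor 1 / e. *)
  have h0 : 0 <= (n%:R - 1) / (e * q).
    by rewrite divr_ge0 ?(ltW c0)// subr_ge0 ler1n.
  have := small_growth q0 E0 h0 S (t := t) _ _ (j := 0) (leq0n n).
  rewrite mulrCA mulfV ?lt0r_neq0// mulr1 subn0 exprMn -expRM_natl mulr1.
  have -> : M n / (expR n%:R * q ^+ n) * expR (n%:R - 1) = M 0 / e.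
    rewrite -Mm expRB -/e; field.
    by rewrite !lt0r_neq0 ?expR_gt0// exprn_gt0.
  apply; last by case/andP: tT.
  case/andP: tT => -> /le_trans; apply; apply: le_trans TE _.
  rewrite lerD2l sumr_const card_ord -mulr_natl invfM mulrCA.
  by rewrite le_eqVlt; apply/orP; left; apply/eqP; ring.
have [q' [a [q'0 [k km Mk] _ [a0 aM aMm aT IHS]]]] := IH m mn m0.
(* The slopes of the polygon decrease towards the left: q' <= q. *)
have mqk : M m <= M k * q ^+ (m - k).
  have := qn _ (ltn_trans km mn); rewrite -Mm.
  have -> : (n - k)%N = ((m - k) + (n - m))%N by rewrite addnC addnBA ?subnK// ltnW.
  by rewrite exprD mulrA ler_pM2r// exprn_gt0.
have q'q : q' <= q.
  have := mqk; rewrite -Mk ler_pM2l//.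
  by rewrite ler_pXn2r ?subn_gt0// nnegrE ltW.
exists (fun i => if (i < m)%N then a i else q^-1).
have prodlt k' : (k' <= m)%N -> \prod_(i < k') (if (i < m)%N then a i else q^-1) =
    \prod_(i < k') a i.
  by move=> k'm; apply: eq_bigr => i _; rewrite (leq_trans (ltn_ord i) k'm).
have prodge k' : \prod_(i < m + k') (if (i < m)%N then a i else q^-1) =
    (\prod_(i < m) a i) / q ^+ k'.
  rewrite big_split_ord /= prodlt//; congr (_ * _).
  under eq_bigr => i _ do rewrite ltnNge leq_addr /=.
  by rewrite prodr_const card_ord exprVn.
have sumge k' : \sum_(i < m + k') (if (i < m)%N then a i else q^-1) =
    (\sum_(i < m) a i) + k'%:R / q.
  rewrite big_split_ord /=; congr (_ + _).
    by apply: eq_bigr => i _; rewrite ltn_ord.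
  under eq_bigr => i _ do rewrite ltnNge leq_addr /=.
  by rewrite sumr_const card_ord mulr_natl.
have eqn : n = (m + (n - m))%N by rewrite subnKC// ltnW.
split => //; first by exists m.
have qX0 k' : q ^+ k' != 0 by rewrite expf_neq0// lt0r_neq0.
have Mn0 : M 0 = M n * \prod_(i < n) (if (i < m)%N then a i else q^-1).
  have := prodge (n - m)%N; rewrite -eqn => ->; rewrite aMm -Mm.
  by field.
split => //.
- by move=> i; case: ifP => // _; rewrite invr_gt0.
- move=> k'; have [k'm _|mk k'n] := leqP k' m; first by rewrite prodlt// aM.
  move: k'n; rewrite leq_eqVlt => /predU1P[->|k'n]; first by rewrite -Mn0.
  have := qn _ k'n; have := prodge (k' - m)%N; rewrite subnKC ?(ltnW mk)// => ->; rewrite -Mm aMm.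
  have -> : (n - m)%N = ((k' - m) + (n - k'))%N.
    by rewrite addnC addnBA ?subnK// ltnW.
  rewrite exprD mulrA ler_pM2r ?exprn_gt0// => H.
  rewrite mulrA ler_pdivlMr ?exprn_gt0// mulrAC ler_pM2r//.
  by apply: prodr_gt0.
- by rewrite m0.
move=> E E0 S TE; rewrite m0 in TE.
have h0 : 0 <= (n - m)%:R / (e * q) by rewrite divr_ge0// ltW.
apply: (IHS (E + (n - m)%:R / (e * q))); first by rewrite addr_ge0.
  move=> x xE xT j jm.
  have := small_growth q0 E0 h0 S xE xT (ltnW (ltn_trans jm mn)).
  move/le_trans; apply.
  rewrite mulrCA mulfV ?mulr1 ?lt0r_neq0// -[expR _]/(expR (n - m)%:R).
  rewrite -[(n - m)%:R]mulr1 expRM_natl -/e.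
  have -> : (n - j)%N = ((m - j) + (n - m))%N.
    by rewrite addnC addnBA ?subnK// ltnW.
  rewrite -Mm exprD [(e * q) ^+ (n - m)]exprMn.
  rewrite (_ : _ * _ = M m / (e * q) ^+ (m - j)).
    rewrite ler_pM2l// lef_pV2 ?posrE ?exprn_gt0// ?mulr_gt0 ?expR_gt0//.
    by rewrite lerXn2r ?nnegrE ?mulr_ge0 ?expR_ge0 ?(ltW q0) ?(ltW q'0)// ler_pM2l ?expR_gt0.
  by field; rewrite !expf_neq0// lt0r_neq0// expR_gt0.
apply: le_trans TE _; have := sumge (n - m)%N; rewrite -eqn => ->.
rewrite le_eqVlt; apply/orP; left; apply/eqP; field.
by rewrite !lt0r_neq0// expR_gt0.
Qed.
End BangChain.

(** The numbers r_k play the part of (M_0 / M_k)^(1/k).  Only M_0 has to be the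
    exact supremum; the bound |F_0| <= M_0 / e then contradicts M_0 > 0. *)
Lemma Denjoy_Carleman (R : realType) (T : R) (F : nat -> R -> R[i]) (M r : nat -> R) :
  0 < T -> (forall k, has_deriv_on 0 T (F k) (F k.+1)) -> (forall k, F k 0 = 0) ->
  (forall k (t : R), 0 <= t <= T -> normc (F k t) <= M k) ->
  (forall c, (forall t : R, 0 <= t <= T -> normc (F 0 t) <= c) -> M 0 <= c) ->
  (forall k, 0 <= r k) -> (forall k, r k.+1 ^+ k.+1 * M k.+1 <= M 0) ->
  (forall C : R, exists N, C <= \sum_(k < N) r k.+1) ->
  M 0 <= 0.
Proof.
move=> T0 dF F0 FM supM0 r0 rM rdiv; rewrite leNgt; apply/negP => M0.
have MT k : M 0 <= M k * T ^+ k by apply: supM0 => t; exact: vanishing_bound.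
have Mgt0 k : 0 < M k.
  have := lt_le_trans M0 (MT k); rewrite pmulr_lgt0//; exact: exprn_gt0.
have e0 : 0 < expR 1 :> R by exact: expR_gt0.
(* The sum of the a_i has to reach e T + a_0, and a_0 <= T; the final 1 rules out N = 0. *)
have [N rN] := rdiv (expR 1 * (expR 1 * T + T) + 1).
have N0 : (0 < N)%N.
  case: N rN => //; rewrite big_ord0 => /(lt_le_trans _) => /(_ 0).
  by rewrite ltxx; apply; rewrite ltr_wpDl// mulr_ge0 ?addr_ge0 ?mulr_ge0// ltW.
have [q [a [q0 _ _ [a0 aM _ aT concl]]]] := bang_chain T0 dF FM Mgt0 MT N0.
have sum_a : expR 1 * T + T <= \sum_(i < N) a i.
  rewrite -(ler_pM2l e0); apply: le_trans (_ : \sum_(k < N) r k.+1 <= _).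
    by apply: le_trans rN; rewrite lerDl.
  apply: Carleman_inequality => // [i|k kN]; first exact/ltW/a0.
  rewrite -(ler_pM2r (Mgt0 k.+1)); apply: le_trans (rM k) _.
  by rewrite mulrC; exact: aM.
have S : small_up_to T F M N q 0.
  move=> x; rewrite -eq_le => /eqP <- _ j jN; rewrite F0 normc0.
  by rewrite divr_ge0 ?exprn_ge0 ?mulr_ge0 ?expR_ge0// ltW.
have M0e : M 0 <= M 0 / expR 1.
  apply: supM0; apply: (concl 0) => //; rewrite add0r ler_pdivlMr//; lra.
by move: M0e; rewrite ler_pdivlMr// ger_pMr// leNgt expR_gt1 ltr01.
Qed.

(** * Derivatives along a segment *)

Section Segment.
Variable R : realType.
Implicit Types (x y z w : R[i]) (A J : set R[i]) (f : R[i] -> R[i]).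

Lemma nbhs_complexP x A :
  nbhs x A <-> exists2 r : R, 0 < r & forall y, normc (y - x) < r -> A y.
Proof.
have normE z : `|z| = (normc z)%:C by [].
split=> [/nbhs_normP [e /= e0 h]|[r r0 h]].
  exists (complex.Re e); first by move: e0; rewrite ltcE /= => /andP[].
  move=> y yr; apply: h; rewrite /= normE ltcE /= normc_distC yr andbT.
  by move: e0; rewrite ltcE /= => /andP[].
apply/nbhs_normP; exists (r%:C); first by rewrite /= ltcR.
by move=> y /=; rewrite normE ltcR normc_distC => yr; exact: h.
Qed.

Lemma differentiable_on_eps J f z : differentiable_on J f -> J z ->
  forall e : R, 0 < e -> exists2 d : R, 0 < d & forall w, J w -> normc (w - z) < d ->
  normc (f w - f z - (w - z) * derive_on J f z) <= e * normc (w - z).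
Proof.
move=> df Jz e e0; have := df _ Jz.
rewrite -/(derive_on J f z) => cv.
have nb : nbhs (derive_on J f z) [set w | normc (w - derive_on J f z) < e].
  by apply/nbhs_complexP; exists e.
have /nbhs_complexP [d d0 hd] := cv _ nb.
exists d => // w Jw wd; have [->|wz] := eqVneq w z.
  by rewrite !subrr mul0r subrr normc0 mulr0.
have wz0 : w - z != 0 by rewrite subr_eq0.
have /= := hd w wd wz Jw; rewrite /diff_quot => /ltW H.
rewrite (_ : _ - _ - _ = ((f w - f z) / (w - z) - derive_on J f z) * (w - z)).
  by rewrite normcM ler_wpM2r ?normc_ge0.
by rewrite [RHS]mulrBl divfK// (mulrC (derive_on _ _ _)).
Qed.

Definition segment x y : set R[i] := [set x + t%:C * (y - x) | t in [set t : R | 0 <= t <= 1]].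

Lemma segment_left x y : segment x y x.
Proof. by exists 0; rewrite /= ?lexx ?ler01// mul0r addr0. Qed.

Lemma segment_right x y : segment x y y.
Proof. by exists 1; rewrite /= ?lexx ?ler01// mul1r addrC subrK. Qed.

(** Without this, the limits along the segment would not be unique. *)
Lemma segment_no_isolated x y z (d : R) : x <> y -> segment x y z -> 0 < d ->
  exists w, [/\ segment x y w, w != z & normc (w - z) < d].
Proof.
move=> /eqP xy [t /= /andP[t0 t1] <-] d0.
have L0 : 0 < normc (y - x).
  by rewrite normcB_gt0 eq_sym.
pose s := Num.min (1 / 2) (d / (2 * normc (y - x))).
have s0 : 0 < s by rewrite lt_min !divr_gt0 ?mulr_gt0.
have s2 : s <= 1 / 2 by rewrite ge_min lexx.
have sd : s * normc (y - x) < d.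
  apply: le_lt_trans (_ : d / 2 < d); last by lra.
  rewrite -ler_pdivlMr//; apply: le_trans (_ : d / (2 * normc (y - x)) <= _).
    by rewrite ge_min lexx orbT.
  by rewrite invfM mulrA.
have [t' [t'01 tt']] : exists t' : R, 0 <= t' <= 1 /\ `|t' - t| = s.
  have [t2|t2] := leP t (1 / 2).
    exists (t + s); rewrite (_ : t + s - t = s); last by ring.
    by rewrite gtr0_norm//; split=> //; apply/andP; split; lra.
  exists (t - s); rewrite (_ : t - s - t = - s); last by ring.
  by rewrite normrN gtr0_norm//; split=> //; apply/andP; split; lra.
have E : x + t'%:C * (y - x) - (x + t%:C * (y - x)) = (t' - t)%:C * (y - x).
  by ring.
exists (x + t'%:C * (y - x)); split; first by exists t'.
- rewrite -subr_eq0 E -normc_eq0 normcM normcR tt'.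
  by rewrite mulf_neq0// lt0r_neq0.
- by rewrite E normcM normcR tt'.
Qed.

Lemma derive_onn_vanish x y f (d : R) : x <> y -> infinitely_differentiable_on (segment x y) f ->
  (forall w, segment x y w -> normc (w - x) < d -> f w = 0) ->
  forall k w, segment x y w -> normc (w - x) < d -> derive_onn (segment x y) k f w = 0.
Proof.
set J := segment x y; move=> xy df f0; elim=> [|k IH] z Jz zd; first exact: f0.
apply/eqP; rewrite -normc_eq0 eq_le normc_ge0 andbT; apply/ler_addgt0Pl => e e0.
rewrite addr0.
have [d' d'0 hd] := differentiable_on_eps (df k) Jz e0.
have [|w [Jw wz]] := @segment_no_isolated x y z (Num.min d' (d - normc (z - x))) xy Jz.
  by rewrite lt_min d'0 subr_gt0.
rewrite lt_min => /andP[wd' wd]; have := hd _ Jw wd'.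
rewrite (IH _ Jz zd) IH//; last first.
  rewrite (_ : w - x = (w - z) + (z - x)); last by ring.
  by apply: le_lt_trans (le_normcD _ _) _; rewrite -ltrBrDr.
rewrite subrr sub0r normcN normcM mulrC ler_pM2r//.
by rewrite normcB_gt0.
Qed.

(** The successive derivatives of t |-> f (x + t u), where u is the unit vector
    from x to y: in this parametrization the sup norms of the derivatives are
    those of the derivatives of f along the segment. *)
Definition segment_jet x y f (k : nat) (t : R) : R[i] :=
  let u := (y - x) / (normc (y - x))%:C in
  u ^+ k * derive_onn (segment x y) k f (x + t%:C * u).

Section Jet.
Variables (x y : R[i]) (f : R[i] -> R[i]).
Hypothesis xy : x <> y.
Let L := normc (y - x).
Let u := (y - x) / L%:C.

Let L0 : 0 < L.
Proof. by rewrite normcB_gt0; apply/eqP => /esym. Qed.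

Let u1 : normc u = 1.
Proof. by rewrite normcM normcV normcR (gtr0_norm L0) divff// lt0r_neq0. Qed.

Lemma segment_unit (w : R[i]) :
  segment x y w <-> exists2 t : R, 0 <= t <= L & w = x + t%:C * u.
Proof.
have LC : L%:C != 0 by rewrite -normc_eq0 normcR normr_eq0 lt0r_neq0.
have E t : (t * L)%:C * u = t%:C * (y - x).
  by rewrite /u; field.
split=> [[t /= /andP[t0 t1] <-]|[t /andP[t0 tL] ->]].
  by exists (t * L); rewrite ?E// mulr_ge0 ?(ltW L0)//= ler_piMl ?(ltW L0).
exists (t / L); last by rewrite -E divfK// lt0r_neq0.
by rewrite /= divr_ge0 ?(ltW L0)//= ler_pdivrMr// mul1r.
Qed.

Lemma segment_jet_deriv (k : nat) : infinitely_differentiable_on (segment x y) f ->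
  has_deriv_on 0 L (segment_jet x y f k) (segment_jet x y f k.+1).
Proof.
move=> df t tL e e0.
have Jt : segment x y (x + t%:C * u) by apply/segment_unit; exists t.
have [d d0 hd] := differentiable_on_eps (df k) Jt e0.
exists d => // s sL std.
have Js : segment x y (x + s%:C * u) by apply/segment_unit; exists s.
have E : x + s%:C * u - (x + t%:C * u) = (s - t)%:C * u by ring.
have := hd _ Js; rewrite E normcM normcR u1 mulr1 => /(_ std).
apply: le_trans; rewrite /segment_jet -/L -/u.
rewrite (_ : _ - _ - _ = u ^+ k * (derive_onn (segment x y) k f (x + s%:C * u) -
  derive_onn (segment x y) k f (x + t%:C * u) -
  (s - t)%:C * u * derive_on (segment x y) (derive_onn (segment x y) k f) (x + t%:C * u))).
  rewrite normcM (_ : normc (u ^+ k) = 1) ?mul1r//.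
  by elim: (k) => [|j IH]; rewrite ?normc1// exprS normcM u1 IH mulr1.
rewrite exprS -[derive_onn _ k.+1 _ _]/(derive_on (segment x y) (derive_onn (segment x y) k f) _).
by ring.
Qed.

Lemma normc_segment_jet (k : nat) t :
  normc (segment_jet x y f k t) = normc (derive_onn (segment x y) k f (x + t%:C * u)).
Proof.
rewrite normcM (_ : normc _ = 1) ?mul1r//.
by elim: (k) => [|j IH]; rewrite ?normc1// exprS normcM u1 IH mulr1.
Qed.
End Jet.
End Segment.

Lemma has_deriv_bounded (R : realType) (a b : R) (F D : R -> R[i]) : a <= b ->
  has_deriv_on a b F D -> exists C : R, forall t : R, a <= t <= b -> normc (F t) <= C.
Proof.
move=> ab dF.
have cF : {within `[a, b], continuous (fun t => normc (F t))}.
  apply/subspace_continuousP => t; rewrite /= in_itv /= => tab.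
  apply/cvgrPdist_le => e e0; have [d d0 hd] := dF _ tab _ ltr01.
  have l0 : 0 < 1 + normc (D t) by rewrite ltr_pwDl// normc_ge0.
  apply/nbhs_normP; exists (Num.min d (e / (1 + normc (D t)))).
    by rewrite /= lt_min d0 divr_gt0.
  move=> s /=; rewrite distrC lt_min => /andP[sd se]; rewrite in_itv /= => sab.
  have {}hd := hd _ sab sd; rewrite mul1r in hd; rewrite ltr_pdivlMr // in se.
  have H : normc (F s - F t) <= e.
    rewrite -[F s - F t](subrK ((s - t)%:C * D t)).
    apply: le_trans (le_normcD _ _) _; rewrite normcM normcR.
    by apply: le_trans (ltW se); rewrite mulrDr mulr1 lerD2r.
  have H1 := le_normcD (F s - F t) (F t); rewrite subrK in H1.
  have H2 := le_normcD (F t - F s) (F s); rewrite subrK normc_distC in H2.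
  rewrite ler_norml lerNl opprB !lerBlDr (le_trans H1) ?lerD2r//=.
  by rewrite (le_trans H2)// lerD2r.
have [c _ hc] := EVT_max ab cF.
by exists (normc (F c)) => t tab; apply: hc; rewrite in_itv.
Qed.

Lemma nneseries_pinfty_unbounded (R : realType) (u : nat -> \bar R) (v : nat -> R) :
  (forall k, (0 < k)%N -> u k = (v k)%:E) -> (forall k, 0 <= v k) ->
  (\sum_(1 <= k <oo) u k = +oo)%E ->
  forall C : R, exists N, C <= \sum_(k < N) v k.+1.
Proof.
move=> uv v0 uoo C; apply: contrapT => /forallNP hC.
have : (\sum_(1 <= k <oo) u k <= C%:E)%E.
  apply: lime_le.
    by apply: is_cvg_nneseries => n n1 _; rewrite uv// lee_fin.
  apply: nearW => -[|n]; first by rewrite big_geq// leNgt lte_fin; apply/negP => C0;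
    apply: (hC 0%N); rewrite big_ord0 ltW.
  rewrite big_add1 /= big_mkord (eq_bigr (fun k : 'I_n => (v k.+1)%:E)).
    by rewrite sumEFin lee_fin; move/negP: (hC n); rewrite -ltNge => /ltW.
  by move=> i _; rewrite uv.
by rewrite uoo leye_eq.
Qed.

(** [Denjoy_Carleman] asks for the k-th term of the series to be multiplied by
    M_0^(1/k), where M_0 is the sup norm of f; this preserves divergence as
    M_0^(1/k) >= min(1, M_0). *)
Lemma quasianalytic_segment (R : realType) (x y : R[i]) (f : R[i] -> R[i]) :
  x <> y -> infinitely_differentiable_on (segment x y) f ->
  quasianalytic_sum (segment x y) f = +oo%E ->
  (forall k, derive_onn (segment x y) k f x = 0) -> f y = 0.
Proof.
set J := segment x y => xy df qf fx.
pose L := normc (y - x); pose u := (y - x) / L%:C.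
have L0 : 0 < L.
  by rewrite normcB_gt0; apply/eqP => /esym.
pose F := segment_jet x y f.
have dF k : has_deriv_on 0 L (F k) (F k.+1) by exact: segment_jet_deriv.
pose M k := fine (sup_norm_on J (derive_onn J k f)).
have supE k : sup_norm_on J (derive_onn J k f) = (M k)%:E.
  have [C hC] := has_deriv_bounded (ltW L0) (dF k).
  rewrite fineK// fin_numElt; apply/andP; split.
    apply: (@lt_le_trans _ _ 0%E); first exact: ltNyr.
    apply: ereal_sup_ge; exists (normc (derive_onn J k f x))%:E.
      by exists x => //; exact: segment_left.
    by rewrite lee_fin normc_ge0.
  apply: (@le_lt_trans _ _ C%:E); last exact: ltry.
  apply: ub_ereal_sup => _ [z /(segment_unit xy) [t tL ->]] <-.
  by rewrite lee_fin -normc_segment_jet//; exact: hC.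
have FM k t : 0 <= t <= L -> normc (F k t) <= M k.
  move=> tL; rewrite normc_segment_jet// -lee_fin -supE.
  apply: ereal_sup_ubound; exists (x + t%:C * u) => //.
  by apply/(segment_unit xy); exists t.
have supM0 c : (forall t : R, 0 <= t <= L -> normc (F 0 t) <= c) -> M 0 <= c.
  move=> hc; rewrite -lee_fin -supE; apply: ub_ereal_sup => _ [z /(segment_unit xy) [t tL ->]] <-.
  by rewrite lee_fin -normc_segment_jet//; exact: hc.
have F0 k : F k 0 = 0 by rewrite /F /segment_jet mul0r addr0 fx mulr0.
suff M0 : M 0 <= 0.
  have [t tL yt] := (segment_unit xy y).1 (segment_right x y).
  apply/eqP; rewrite -normc_eq0 eq_le normc_ge0 andbT; apply: le_trans M0.
  apply: le_trans (FM 0%N t tL).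
  by rewrite normc_segment_jet// -/L -/u -yt.
rewrite leNgt; apply/negP => M0.
have Mgt0 k : 0 < M k.
  have MT : M 0 <= M k * L ^+ k by apply: supM0 => t tL; exact: (vanishing_bound L0 dF F0 FM).
  have := lt_le_trans M0 MT; rewrite pmulr_lgt0//; exact: exprn_gt0.
(* A lower bound for all the numbers M_0^(1/k). *)
pose m := Num.min 1 (M 0).
have m0 : 0 < m by rewrite lt_min ltr01.
pose r k := m * (M k `^ k%:R^-1)^-1.
have rM k : r k.+1 ^+ k.+1 * M k.+1 <= M 0.
  have root : (M k.+1 `^ k.+1%:R^-1) ^+ k.+1 = M k.+1.
    by rewrite -powR_mulrn ?powR_ge0// -powRrM mulVf// powRr1// ltW.
  rewrite /r exprMn exprVn root.
  rewrite divfK ?lt0r_neq0//; apply: le_trans (_ : m <= _); last by rewrite ge_min lexx orbT.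
  by rewrite exprS ler_piMr ?exprn_ile1 ?ge_min ?lexx// ltW.
suff : M 0 <= 0 by rewrite leNgt M0.
apply: (Denjoy_Carleman L0 dF F0 FM supM0 (r := r)) => //.
  by move=> k; rewrite mulr_ge0 ?(ltW m0)// invr_ge0 powR_ge0.
move=> C.
have [|k|N hN] := @nneseries_pinfty_unbounded R
  (fun k => ((poweR (sup_norm_on J (derive_onn J k f)) k%:R^-1)^-1)%E)
  (fun k => (M k `^ k%:R^-1)^-1) _ _ qf (C / m).
- by move=> k _; rewrite supE /= inver gt_eqF// powR_gt0.
- by rewrite invr_ge0 powR_ge0.
- exists N; rewrite /r -mulr_sumr mulrC -ler_pdivrMr//.
Qed.

(** A germ of f at x determines all derivatives of f at x along the segment. *)
Lemma quasianalytic_unique_continuation (R : realType) (x y : R[i]) (f : R[i] -> R[i]) :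
  x <> y -> infinitely_differentiable_on (segment x y) f ->
  quasianalytic_sum (segment x y) f = +oo%E ->
  within (segment x y) (nbhs x) (f @^-1` [set 0]) -> f y = 0.
Proof.
move=> xy df qf /nbhs_complexP [d d0 hd].
apply: (quasianalytic_segment xy df qf) => k.
apply: (@derive_onn_vanish R x y f d xy df).
- by move=> w Jw wd; exact: hd.
- exact: segment_left.
- by rewrite subrr normc0.
Qed.

(** * Runge's theorem with one pole *)

Section Runge.
Variable R : realType.
Implicit Types (K : set R[i]) (x z w : R[i]).

(** z - zeta is invertible in the uniform closure of the polynomials on K.
    The product form avoids dividing by z - zeta. *)
Definition poly_invertible K (zeta : R[i]) : Prop := forall e : R, 0 < e ->
  exists p : {poly R[i]}, forall z, K z -> normc (p.[z] * (z - zeta) - 1) < e.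

Lemma normcX z n : normc (z ^+ n) = normc z ^+ n.
Proof. by elim: n => [|n IH]; rewrite ?normc1// !exprS normcM IH. Qed.

Lemma geometric_tail_lt (q e : R) : 0 <= q -> q < 1 -> 0 < e -> exists n, q ^+ n < e.
Proof.
move=> q0 q1 e0.
have /cvgrPdist_lt /(_ _ e0) [n _ hn] : q ^+ n @[n --> \oo] --> (0:R).
  by apply: cvg_expr; rewrite ger0_norm.
exists n; have := hn n (leqnn n); rewrite /= sub0r normrN.
by apply: le_lt_trans; rewrite ler_norm.
Qed.

Lemma normc_geom_le (u : R[i]) (q : R) n : normc u <= q -> q < 1 ->
  normc (\sum_(k < n) u ^+ k) <= (1 - q)^-1.
Proof.
move=> uq q1; have q0 : 0 <= q := le_trans (normc_ge0 u) uq.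
apply: le_trans (_ : \sum_(k < n) q ^+ k <= _).
  elim: n => [|n IH]; first by rewrite !big_ord0 normc0.
  rewrite !big_ord_recr /=; apply: le_trans (le_normcD _ _) _.
  by rewrite lerD// normcX lerXn2r ?nnegrE ?normc_ge0.
have q1' : 0 < 1 - q by rewrite subr_gt0.
rewrite -(ler_pM2l q1') mulfV ?lt0r_neq0// -[1 - q]opprB mulNr -subrX1 opprB.
by rewrite gerBl exprn_ge0.
Qed.

(** Neumann series: z - zeta' = (z - zeta) (1 - c / (z - zeta)) with
    c = zeta' - zeta, and |c / (z - zeta)| <= 1/2 on K. *)
Lemma poly_invertible_near K (zeta zeta' : R[i]) (d : R) : 0 < d ->
  (forall z, K z -> d <= normc (z - zeta)) -> normc (zeta' - zeta) <= d / 2 ->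
  poly_invertible K zeta -> poly_invertible K zeta'.
Proof.
move=> d0 Kd zd inv e e0; set c := zeta' - zeta.
(* With this precision |c p| <= 3/4 on K, so the partial geometric sums are at most 4. *)
pose eps := Num.min (1 / 2) (e / 8).
have eps0 : 0 < eps by rewrite lt_min !divr_gt0.
have eps2 : eps <= 1 / 2 by rewrite ge_min lexx.
have eps8 : eps <= e / 8 by rewrite ge_min lexx orbT.
have [p hp] := inv _ eps0.
have q1 : (3 / 4 : R) < 1 by lra.
have [||n hn] := @geometric_tail_lt (3 / 4) (e / 2) _ q1; [by lra|by lra|].
exists (p * \sum_(k < n) (c *: p) ^+ k) => z Kz.
rewrite hornerM horner_sum.
under eq_bigr => k _ do rewrite horner_exp hornerZ.
set u := c * p.[z]; set S := \sum_(k < n) u ^+ k.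
have u34 : normc u <= 3 / 4.
  have H1 : normc p.[z] * normc (z - zeta) <= 3 / 2.
    rewrite -normcM -[p.[z] * _](subrK 1); apply: le_trans (le_normcD _ _) _.
    by rewrite normc1; have := ltW (hp z Kz); lra.
  have H2 : normc p.[z] * d <= 3 / 2.
    by apply: le_trans H1; rewrite ler_wpM2l ?normc_ge0// Kd.
  rewrite /u normcM; apply: le_trans (_ : d / 2 * normc p.[z] <= _).
    by rewrite ler_wpM2r ?normc_ge0.
  by lra.
have S4 : normc S <= 4.
  apply: le_trans (normc_geom_le _ u34 q1) _.
  by have -> : 1 - 3 / 4 = (4^-1 : R); [field | rewrite invrK].
have -> : p.[z] * S * (z - zeta') - 1 = - u ^+ n + (p.[z] * (z - zeta) - 1) * S.
  have -> : - u ^+ n = (1 - u) * S - 1.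
    by rewrite -[1 - u]opprB mulNr -subrX1; ring.
  by rewrite /u /c; ring.
apply: le_lt_trans (le_normcD _ _) _; rewrite normcN (normcX u) (normcM _ S).
have un : normc u ^+ n < e / 2.
  by apply: le_lt_trans hn; rewrite lerXn2r ?nnegrE ?normc_ge0//; lra.
have vS : normc (p.[z] * (z - zeta) - 1) * normc S <= eps * 4.
  by rewrite ler_pM ?normc_ge0// ltW// hp.
by lra.
Qed.

Lemma poly_invertible_outside K : K `<=` open_disc 0 1 -> poly_invertible K 2.
Proof.
move=> K1 e e0.
have q1 : (1 / 2 : R) < 1 by lra.
have [||n hn] := @geometric_tail_lt (1 / 2) e _ q1; [by lra|by lra|].
have n2 : normc (2^-1 : R[i]) = 1 / 2.
  rewrite normcV (_ : 2 = (2:R)%:C); last by rewrite rmorph_nat.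
  by rewrite normcR ger0_norm// div1r.
exists ((- 2^-1)%:P * \sum_(k < n) (2^-1 *: 'X) ^+ k) => z /K1; rewrite /open_disc /= subr0 => z1.
rewrite hornerM horner_sum hornerC.
under eq_bigr => k _ do rewrite horner_exp hornerZ hornerX.
set u := 2^-1 * z.
have -> : - 2^-1 * (\sum_(i < n) u ^+ i) * (z - 2) - 1 = - u ^+ n.
  have -> : - u ^+ n = (1 - u) * (\sum_(i < n) u ^+ i) - 1.
    by rewrite -[1 - u]opprB mulNr -subrX1; ring.
  by rewrite /u; field.
have u2 : normc u <= 1 / 2 by rewrite /u normcM n2 ler_piMr// ?ltW//; lra.
by rewrite normcN normcX; apply: le_lt_trans hn; rewrite lerXn2r ?nnegrE ?normc_ge0//; lra.
Qed.

Lemma compact_dist K z : compact K -> ~ K z ->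
  exists2 d : R, 0 < d & forall w, K w -> d <= normc (w - z).
Proof.
move=> cK nKz.
have oK : open (~` K) by apply: closed_openC; apply: compact_closed => //; exact: norm_hausdorff.
have /nbhs_complexP [d d0 hd] : nbhs z (~` K) by exact: open_nbhs_nbhs.
by exists d => // w Kw; rewrite leNgt; apply/negP => /hd; apply.
Qed.

(** Pole pushing: the set of admissible poles is open and closed in the
    complement of K, because the step allowed by [poly_invertible_near] depends
    only on the distance to K; and it contains the point 2. *)
Lemma Runge_poly_invertible K zeta : compact K -> K `<=` open_disc 0 1 ->
  connected (~` K) -> ~ K zeta -> poly_invertible K zeta.
Proof.
move=> cK K1 conn nK.
pose G := [set z | ~ K z /\ poly_invertible K z].
suff GE : G = ~` K by have : G zeta by [rewrite GE]; case.
have Gnear z : ~ K z -> exists2 d : R, 0 < d & forall w, normc (w - z) < d ->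
    ~ K w /\ (poly_invertible K w <-> poly_invertible K z).
  move=> nKz; have [d d0 hd] := compact_dist cK nKz.
  exists (d / 3); first by rewrite divr_gt0.
  move=> w wz; have hw v : K v -> 2 * d / 3 <= normc (v - w).
    move=> Kv; have := hd v Kv; rewrite (_ : v - z = (v - w) + (w - z)); last by ring.
    by have := le_normcD (v - w) (w - z); lra.
  split; first by move=> /hw; rewrite subrr normc0; lra.
  split.
    apply: (@poly_invertible_near K w z (2 * d / 3)) => //; first lra.
    by rewrite normc_distC; lra.
  by apply: (@poly_invertible_near K z w d) => //; lra.
apply: conn.
- exists 2; split; last exact: poly_invertible_outside.
  move=> /K1 K2; have {K2} : normc (2 - 0 : R[i]) < 1 := K2.
  have -> : 2 - 0 = (2 : R)%:C :> R[i] by rewrite subr0 rmorph_nat.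
  by rewrite normcR ger0_norm//; lra.
- exists G; last by rewrite setIidr// => z [].
  rewrite openE => z [nKz Gz]; have [d d0 hd] := Gnear z nKz.
  by apply/nbhs_complexP; exists d => // w /hd [nKw [_ /(_ Gz)]].
- exists (closure G); first exact: closed_closure.
  apply/seteqP; split=> z; first by move=> Gz; split; [case: Gz | exact: subset_closure].
  move=> [nKz clz]; split=> //; have [d d0 hd] := Gnear z nKz.
  have [|w [[_ Gw] wd]] := clz [set w | normc (w - z) < d].
    by apply/nbhs_complexP; exists d.
  by have [_ [H _]] := hd w wd; exact: H.
Qed.
End Runge.

(** * Estimates on a probability space *)

Section MeasureLemmas.
Context d (T : measurableType d) (R : realType).
Variable mu : probability T R.
Local Open Scope ereal_scope.

(** If g <= H almost everywhere and even g <= H - L on A, then integrating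
    bounds the mass of A, provided that the integral of g is bounded below.
    As g may take the value -oo, the inequality is integrated in the form
    g^+ + L 1_A <= H + g^-, where all functions are nonnegative. *)
Lemma concentration (X A N : set T) (g H : T -> \bar R) (c L : R) :
  measurable X -> measurable A -> A `<=` X -> measurable N -> mu N = 0 ->
  measurable_fun X g -> measurable_fun X H -> (forall w, X w -> 0 <= H w) ->
  (0 <= L)%R -> c%:E <= \int[mu]_(w in X) g w ->
  (forall w, X w -> ~ N w -> g w + (L * \1_A w)%:E <= H w) ->
  c%:E + L%:E * mu A <= \int[mu]_(w in X) H w.
Proof.
move=> mX mA AX mN N0 mg mH H0 L0 cg gH.
have mgp : measurable_fun X g^\+ by exact: measurable_funepos.
have mgn : measurable_fun X g^\- by exact: measurable_funeneg.
have mLA : measurable_fun X (fun w => (L * \1_A w)%:E).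
  rewrite -[fun _ => _]/(EFin \o (fun w => L * \1_A w)%R).
  by apply/measurable_EFinP; apply: measurable_funM => //; exact: measurable_indic.
have iLA : \int[mu]_(w in X) (L * \1_A w)%:E = L%:E * mu A.
  under eq_integral do rewrite EFinM.
  rewrite ge0_integralZl_EFin//; last first.
    rewrite -[fun _ => _]/(EFin \o \1_A).
    by apply/measurable_EFinP; exact: measurable_indic.
  by rewrite integral_indic// setIidl.
have ineq : \int[mu]_(w in X) (g^\+ w + (L * \1_A w)%:E) <=
            \int[mu]_(w in X) (H w + g^\- w).
  apply: ae_ge0_le_integral => //.
  - by move=> w Xw; rewrite adde_ge0// lee_fin mulr_ge0.
  - exact: emeasurable_funD.
  - by move=> w Xw; rewrite adde_ge0// H0.
  - exact: emeasurable_funD.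
  exists N; split => // w /= /not_implyP [Xw]; apply: contra_notP => Nw.
  have := gH w Xw Nw; have := H0 w Xw; rewrite funeposE funenegE.
  have negm (x : \bar R) : 0 <= maxe x 0 by rewrite le_max lexx orbT.
  case: (H w) => [h| |] //; last first.
    by move=> _ _; rewrite addye ?leey// gt_eqF// (lt_le_trans ltNy0).
  case: (g w) => [y| |] //=; last by move=> _ _; rewrite maxye addey// leey.
  rewrite !maxEge -EFinD !lee_fin /=; case: (leP 0 y)%R; case: (leP 0 (- y))%R;
    rewrite -!EFinD ?lee_fin; lra.
rewrite ge0_integralD// in ineq; last by move=> w _; rewrite lee_fin mulr_ge0.
rewrite iLA ge0_integralD// in ineq.
move: cg; rewrite integralE.
set P := integral mu X g^\+ in ineq *; set Q := integral mu X g^\- in ineq *.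
have : 0 <= Q by exact: integral_ge0.
case: Q ineq => [q| |]//; last by rewrite addeNy.
move=> ineq q0 cP; rewrite -(leeD2rE (x := q%:E))//.
apply: le_trans ineq; rewrite addeAC leeD2r//.
by move: cP; rewrite leeBrDr.
Qed.

End MeasureLemmas.

Section SelectRadius.
Context d (T : measurableType d) (R : realType).
Variable mu : probability T R.
Variables (s : T -> R) (del : R).
Hypothesis ms : measurable_fun setT s.
Hypothesis del0 : 0 < del.
Local Open Scope ereal_scope.

(** Neighbourhoods, of dyadic widths, of the circle of radius r when s is
    a distance to a point. *)
Definition shell (k : nat) (r : R) : set T :=
  [set w | (`|s w - r| < 2 * del / 2 ^+ k)%R].

Let E (k : nat) : set (T * measurableTypeR R) :=
  [set z | (del <= z.2 <= 2 * del)%R /\ shell k z.2 z.1].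

Let mE k : measurable (E k).
Proof.
have m2 : measurable_fun setT (fun z : T * measurableTypeR R => z.2 : R).
  exact: measurable_snd.
have m1 : measurable_fun setT (fun z : T * measurableTypeR R => `|s z.1 - z.2|%R).
  apply: measurableT_comp => //; apply: measurable_funB => //.
  exact: (measurableT_comp ms measurable_fst).
have -> : E k = ((fun z : T * measurableTypeR R => z.2 : R) @^-1` `[del, (2 * del)%R]%classic) `&`
   ((fun z : T * measurableTypeR R => `|s z.1 - z.2|%R) @^-1` `]-oo, (2 * del / 2 ^+ k)%R[%classic).
  by apply/seteqP; split=> z /=; rewrite /E /shell /= !in_itv.
apply: measurableI; rewrite -[X in measurable X]setTI.
  exact: m2.
exact: m1.
Qed.

Let f (z : T * measurableTypeR R) : \bar R := \sum_(0 <= k <oo) (\1_(E k) z)%:E.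

Let f0 z : 0 <= f z.
Proof. by apply: nneseries_ge0 => k _ _; rewrite lee_fin. Qed.

Let mf : measurable_fun setT f.
Proof.
apply: ge0_emeasurable_sum => [k z _ _|k _]; first by rewrite lee_fin.
rewrite -[fun _ => _]/(EFin \o \1_(E k)).
by apply/measurable_EFinP; exact: measurable_indic.
Qed.

Let inner_integral_le (w : T) : \int[@lebesgue_measure R]_r f (w, r) <= (8 * del)%:E.
Proof.
have secE k r : \1_(E k) (w, r) = \1_(xsection (E k) w) r :> R.
  by rewrite !indicE mem_xsection.
rewrite /f integral_nneseries//; last first.
  move=> k; under eq_fun do rewrite secE.
  rewrite -[fun _ => _]/(EFin \o \1_(xsection (E k) w)).
  by apply/measurable_EFinP; apply: measurable_indic; exact: measurable_xsection.
apply: lime_le.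
  by apply: is_cvg_nneseries => k _ _; apply: integral_ge0 => r _; rewrite lee_fin.
apply: nearW => n; apply: le_trans (_ : \sum_(0 <= k < n) (4 * del / 2 ^+ k)%:E <= _).
  apply: lee_sum => k _; under eq_integral do rewrite secE.
  rewrite integral_indic//; last exact: measurable_xsection.
  rewrite setIT; set a := (2 * del / 2 ^+ k)%R.
  have a0 : (0 < a)%R by rewrite divr_gt0 ?mulr_gt0// exprn_gt0.
  apply: le_trans (_ : lebesgue_measure `](s w - a)%R, (s w + a)%R[%classic <= _).
    apply: le_measure; rewrite ?inE//; first exact: measurable_xsection.
    move=> r; rewrite /= xsectionE /= in_itv /= => -[_].
    by rewrite /shell /= -/a ltr_distlC => /andP[h1 h2]; apply/andP; split; lra.
  rewrite lebesgue_measure_itv /= lte_fin ifT; last by lra.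
  by rewrite -EFinB lee_fin /a; lra.
rewrite sumEFin lee_fin big_mkord.
apply: le_trans (_ : 8 * del * (1 - 1 / 2 ^+ n) <= _)%R; last first.
  by rewrite ler_piMr ?mulr_ge0 ?(ltW del0)// gerBl divr_ge0// exprn_ge0.
elim: n => [|n IH]; first by rewrite big_ord0 expr0 divr1 subrr mulr0.
rewrite big_ord_recr /= exprS.
have := exprn_gt0 n (ltr0n R 2); move: IH; set S := (\sum_(i < n) _)%R.
set p := (2 ^+ n)%R => IH p0.
have -> : (8 * del * (1 - 1 / (2 * p)) = 8 * del * (1 - 1 / p) + 4 * del / p)%R.
  by field; rewrite lt0r_neq0.
by rewrite lerD2r.
Qed.

(** For fixed w, the set of r with w in the k-th shell is an interval of length
    4 del / 2^k, so integrating the number of shells that contain w over r gives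
    at most 8 del.  By Tonelli some r in an interval of length del has
    a mean number of shells that is at most 8, hence at most 9. *)
Lemma select_radius : exists2 r : R, (del <= r <= 2 * del)%R &
  \int[mu]_w (\sum_(0 <= k <oo) (\1_(shell k r) w)%:E) <= 9%:E.
Proof.
pose lam := @lebesgue_measure R.
have H1 : \int[mu]_w \int[lam]_r f (w, r) <= (8 * del)%:E.
  apply: le_trans (_ : \int[mu]_w (8 * del)%:E <= _); last first.
    by rewrite integral_cst//= probability_setT mule1.
  apply: ge0_le_integral => //.
  - by move=> w _; exact: integral_ge0.
  - exact: measurable_fun_fubini_tonelli_F.
apply: contrapT => no.
have H2 : (9 * del)%:E <= \int[lam]_r \int[mu]_w f (w, r).
  apply: le_trans (_ : \int[lam]_r (9 * \1_(`[del, (2 * del)%R]%classic) r)%:E <= _).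
    under eq_integral do rewrite EFinM.
    rewrite ge0_integralZl_EFin//; last first.
      rewrite -[fun _ => _]/(EFin \o \1_(`[del, (2 * del)%R]%classic)).
      by apply/measurable_EFinP; exact: measurable_indic.
    rewrite integral_indic// setIT.
    have lamD : lam `[del, (2 * del)%R]%classic = del%:E.
      rewrite [LHS]lebesgue_measure_itv /= lte_fin ifT; last by rewrite ltr_pMl// ltr1n.
      by rewrite -EFinB; congr EFin; ring.
    by rewrite [X in _ <= _ * X](_ : _ = del%:E); last exact: lamD.
  apply: ge0_le_integral => //.
  - rewrite -[fun _ => _]/(EFin \o (fun r => 9 * \1_(`[del, (2 * del)%R]%classic) r)%R).
    by apply/measurable_EFinP; apply: measurable_funM => //; exact: measurable_indic.
  - exact: measurable_fun_fubini_tonelli_G.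
  move=> r _; have [rD|rD] := boolP (del <= r <= 2 * del)%R; last first.
    rewrite indicE memNset ?mulr0 /= ?in_itv; last exact/negP.
    exact: integral_ge0.
  rewrite indicE mem_set /= ?in_itv// mulr1 leNgt; apply/negP => Glt; apply: no.
  exists r => //; apply: le_trans (ltW Glt); rewrite le_eqVlt; apply/orP; left; apply/eqP.
  apply: eq_integral => w _; rewrite /f; apply: eq_eseriesr => k _; congr EFin.
  rewrite !indicE; congr (nat_of_bool _)%:R; apply/idP/idP => /set_mem H; apply/mem_set.
    by split.
  by case: H.
move: H2; rewrite -(fubini_tonelli _ mf f0) => /le_trans /(_ H1).
by rewrite lee_fin ler_pM2r// ler_nat.
Qed.
End SelectRadius.

(** * Topology and Borel sets of the plane *)

Section Plane.
Variable R : realType.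
Implicit Types (x y z w : R[i]) (X K A : set R[i]) (r : R).

Lemma ler_dist_normc z w : `|normc z - normc w| <= normc (z - w).
Proof.
have H1 := le_normcD (z - w) w; rewrite subrK in H1.
have H2 := le_normcD (w - z) z; rewrite subrK normc_distC in H2.
by rewrite ler_norml lerNl opprB !lerBlDr H1 H2.
Qed.

Lemma continuous_normcB x : continuous (fun z : R[i] => normc (z - x)).
Proof.
move=> z A /nbhs_ballP [e /= e0 hA]; apply/nbhs_complexP; exists e => // w wz.
apply: hA; rewrite /ball /=; apply: le_lt_trans (ler_dist_normc _ _) _.
by rewrite (_ : z - x - (w - x) = z - w) 1?normc_distC//; ring.
Qed.

Lemma continuous_normc : continuous (fun z : R[i] => normc z).
Proof.
have -> : (fun z : R[i] => normc z) = (fun z => normc (z - 0)).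
  by apply/funext => z; rewrite subr0.
exact: continuous_normcB.
Qed.

Lemma open_normcB_lt x r : open [set z | normc (z - x) < r].
Proof.
apply: (@open_comp _ _ (fun z => normc (z - x)) [set y | y < r]) => [z _|].
  exact: continuous_normcB.
exact: open_lt.
Qed.

Lemma open_normcB_gt x r : open [set z | r < normc (z - x)].
Proof.
apply: (@open_comp _ _ (fun z => normc (z - x)) [set y | r < y]) => [z _|].
  exact: continuous_normcB.
exact: open_gt.
Qed.

Lemma closed_normcB_ge x r : closed [set z | r <= normc (z - x)].
Proof.
rewrite (_ : [set z | _] = ~` [set z | normc (z - x) < r]).
  exact/open_closedC/open_normcB_lt.
by apply/seteqP; split=> z /=; rewrite leNgt => /negP.
Qed.

(** Otherwise the disc would cut a proper clopen part out of A. *)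
Lemma circle_meets A x r a b : connected A -> A a -> normc (a - x) < r ->
  A b -> r < normc (b - x) -> exists2 z, A z & normc (z - x) = r.
Proof.
move=> conn Aa ar Ab br; apply: contrapT => no.
have noz z : A z -> normc (z - x) != r by move=> Az; apply/eqP => zr; apply: no; exists z.
suff E : A `&` [set z | normc (z - x) < r] = A.
  have [_ /= /lt_trans /(_ br)] : (A `&` [set z | normc (z - x) < r]) b by rewrite E.
  by rewrite ltxx.
apply: conn.
- by exists a.
- by exists [set z | normc (z - x) < r] => //; exact: open_normcB_lt.
- exists (~` [set z | r < normc (z - x)]); first exact/open_closedC/open_normcB_gt.
  apply/seteqP; split=> z [Az] /= zr; split=> //; first by apply/negP; rewrite -leNgt ltW.
  by rewrite lt_neqAle noz//= leNgt; apply/negP.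
Qed.

Lemma normc_within X (f : R[i] -> R[i]) : {within X, continuous f} ->
  {within X, continuous (fun z => normc (f z))}.
Proof.
move=> /subspace_continuousP cf; apply/subspace_continuousP => z Xz.
exact: (cvg_comp _ _ (cf z Xz) (@continuous_normc (f z))).
Qed.

Lemma R_bounded X f : compact X -> R_ X f ->
  exists2 C : R, 0 <= C & forall w, X w -> normc (f w) <= C.
Proof.
move=> cX [cf _]; have [[w0 Xw0]|] := pselect (X !=set0); last first.
  by move=> X0; exists 0 => // w Xw; exfalso; apply: X0; exists w.
have [c _ hc] := compact_EVT_max (ex_intro _ w0 Xw0) cX (normc_within cf).
by exists (normc (f c)) => [|w Xw]; [exact: normc_ge0 | apply: hc; exact: mem_set].
Qed.

Lemma R_poly X (p : {poly R[i]}) : R_ X (fun z => p.[z]).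
Proof.
split.
  apply: continuous_subspaceT; elim/poly_ind: p => [|p c IH] z.
    rewrite (_ : horner 0 = cst 0); first exact: cst_continuous.
    by apply/funext => w; rewrite horner0.
  rewrite (_ : horner _ = (fun w => p.[w] * w + c)); last first.
    by apply/funext => w; rewrite hornerMXaddC.
  have HM := @cvgM _ _ (nbhs z) (nbhs_filter z) _ _ _ _ (IH z) cvg_id.
  exact: (@cvgD _ _ _ (nbhs z) (nbhs_filter z) _ _ _ _ HM (@cst_continuous _ _ c z)).
move=> e e0; exists p, 1 => z _; rewrite hornerE divr1 subrr normc0 oner_neq0.
by split.
Qed.

Lemma open_borel A : open A -> measurable (A : set (borelC R)).
Proof. by move=> oA; exact: sub_sigma_algebra. Qed.

Lemma closed_borel A : closed A -> measurable (A : set (borelC R)).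
Proof.
move=> cA; rewrite -[A]setCK; apply: measurableC; apply: open_borel.
exact: closed_openC.
Qed.

Lemma compact_borel A : compact A -> measurable (A : set (borelC R)).
Proof.
by move=> cA; apply: closed_borel; apply: compact_closed => //; exact: norm_hausdorff.
Qed.

Lemma measurable_within_closed A (g : R[i] -> R) : closed A -> {within A, continuous g} ->
  measurable_fun (A : set (borelC R)) (g : borelC R -> R).
Proof.
move=> clA /subspace_continuousP cg.
apply: (measurability _ (RGenCInfty.measurableE R)) => _ [_ [a ->] <-].
apply: closed_borel => z /= clz.
have Az : A z by apply: clA => B nB; have [w [[Aw _] Bw]] := clz B nB; exists w.
split=> //; rewrite /= in_itv /= andbT leNgt; apply/negP => gza.
have /(clz _) [w [[Aw]]] : nbhs z (fun w => A w -> g w < a).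
  exact: (cg z Az [set y | y < a] (lt_nbhsl gza)).
by rewrite /= in_itv /= andbT => agw /(_ Aw); rewrite ltNge agw.
Qed.

Lemma measurable_lne d (T : measurableType d) (D : set T) (g : T -> R) :
  measurable_fun D g -> measurable_fun D (fun t => lne (g t)%:E).
Proof.
move=> mg mD; move: (mD).
rewrite -[fun _ => _]/(fun t => if (g t <= 0)%R then -oo%E else (EFin \o (@ln R \o g)) t).
apply: measurable_fun_if => //.
- exact: measurable_fun_ler.
- apply: (measurable_funS mD); first exact: subIsetl.
  by apply/measurable_EFinP; exact: measurableT_comp.
Qed.

Lemma small_mass (m K : R) : 0 <= m -> (forall L, 0 <= L -> L * m <= K) -> m = 0.
Proof.
move=> m0 H; apply/eqP; rewrite eq_le m0 andbT leNgt; apply/negP => mgt0.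
have K0 : 0 <= K by have := H 0 (lexx _); rewrite mul0r.
have := H ((K + 1) / m); rewrite divfK ?lt0r_neq0// => /(_ _).
by rewrite divr_ge0 ?addr_ge0// => /(_ isT); lra.
Qed.

(** Finitely many of the null discs cover L. *)
Lemma compact_null (mu : probability (borelC R) R) X L :
  compact L -> measurable (X : set (borelC R)) ->
  (forall y, L y -> exists2 r : R, 0 < r & mu (X `&` open_disc y r) = 0%E) ->
  mu (X `&` L) = 0%E.
Proof.
move=> cL mX hL.
have /choice [r hr] : forall y, exists r : R, L y -> 0 < r /\ mu (X `&` open_disc y r) = 0%E.
  move=> y; have [Ly|nLy] := pselect (L y); last by exists 0.
  by have [r r0 hr] := hL y Ly; exists r.
have mdisc y s : measurable (X `&` open_disc y s : set (borelC R)).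
  by apply: measurableI => //; apply: open_borel; exact: open_normcB_lt.
move: (cL); rewrite compact_cover.
move=> /(_ (R[i] : choiceType) L (fun y => open_disc y (r y))) [|y Ly|D DL LD].
- by move=> y _; exact: open_normcB_lt.
- by exists y => //; rewrite /open_disc /= subrr normc0; case: (hr y Ly).
have cov : X `&` L `<=` \bigcup_(y in [set` D]) (X `&` open_disc y (r y)).
  by move=> w [Xw /LD [y Dy yw]]; exists y.
have [mU U0] : measurable (\bigcup_(y in [set` D]) (X `&` open_disc y (r y)) : set (borelC R)) /\
    mu (\bigcup_(y in [set` D]) (X `&` open_disc y (r y))) = 0%E.
  rewrite bigcup_fset big_seq.
  apply: (big_ind (fun B : set (borelC R) => measurable B /\ mu B = 0%E))
    => [|A B [mA A0] [mB B0]|y yD].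
  - by split; [exact: measurable0 | exact: measure0].
  - split; first exact: measurableU.
    exact: null_set_setU.
  - have [_ mu0] := hr y (set_mem (DL y yD)).
    by split; [exact: mdisc | exact: mu0].
have mXL : measurable (X `&` L : set (borelC R)).
  by apply: measurableI => //; exact: compact_borel.
exact: (subset_measure0 mXL mU cov U0).
Qed.
End Plane.

(** * Supports of Jensen measures *)

Section Jensen.
Variable R : realType.
Variables (X : set R[i]) (x : R[i]) (mu : probability (borelC R) R).
Hypothesis cX : compact X.
Hypothesis Jmu : Jensen_measure X x mu.

Let mX : measurable (X : set (borelC R)).
Proof. exact: compact_borel. Qed.

Let muX : mu X = 1%E.
Proof. by case: Jmu => -[]. Qed.

(** [concentration] for g = log|f|, whose integral Jensen's inequality bounds
    below by log|f(x)|. *)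
Lemma Jensen_concentration (f : R[i] -> R[i]) (A N : set (borelC R))
    (H : borelC R -> \bar R) (c L B : R) :
  R_ X f -> expR c <= normc (f x) ->
  measurable A -> A `<=` X -> measurable N -> mu N = 0%E ->
  measurable_fun (X : set (borelC R)) H -> (forall w, X w -> 0 <= H w)%E ->
  (\int[mu]_(w in X) H w <= B%:E)%E -> 0 <= L ->
  (forall w, X w -> ~ N w -> (lne (normc (f w))%:E + (L * \1_A w)%:E <= H w)%E) ->
  c + L * fine (mu A) <= B.
Proof.
move=> Rf cf mA AX mN N0 mH H0 HB L0 hH.
have mg : measurable_fun (X : set (borelC R)) (fun w : borelC R => lne (normc (f w))%:E).
  apply: measurable_lne; apply: measurable_within_closed; last exact/normc_within/Rf.1.
  by apply: compact_closed => //; exact: norm_hausdorff.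
have cJ : (c%:E <= \int[mu]_(w in X) lne (normc (f w))%:E)%E.
  apply: le_trans (Jmu.2 f Rf); rewrite lne_EFin; last by rewrite (lt_le_trans (expR_gt0 c)).
  by rewrite lee_fin -[leLHS]expRK ler_ln// ?posrE ?expR_gt0// (lt_le_trans (expR_gt0 c)).
have := concentration mX mA AX mN N0 mg mH H0 L0 cJ hH.
move=> /le_trans /(_ HB).
by rewrite -[mu A]fineK ?fin_num_measure// -EFinM -EFinD lee_fin.
Qed.

Lemma measure_fine_eq0 (A : set (borelC R)) : measurable A -> fine (mu A) = 0 -> mu A = 0%E.
Proof. by move=> mA A0; rewrite -[mu A]fineK ?fin_num_measure// A0. Qed.

(** Some f in J_y does not vanish at x.  As log|f| is -oo near y,
    [Jensen_concentration] holds with every L. *)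
Lemma Jensen_support (y : R[i]) : ~ (J_ X y `<=` M_ X x) ->
  exists2 r : R, 0 < r & mu (X `&` open_disc y r) = 0%E.
Proof.
move=> /existsNP [f /not_implyP [[Rf f0] nM]].
have fx : f x != 0 by apply/eqP => fx0; apply: nM.
have [r r0 hr] := (nbhs_complexP _ _).1 f0; exists r => //.
have [C C0 hC] := R_bounded cX Rf.
have mA : measurable (X `&` open_disc y r : set (borelC R)).
  by apply: measurableI => //; apply: open_borel; exact: open_normcB_lt.
apply: measure_fine_eq0 => //.
have fx0 : 0 < normc (f x) by rewrite normc_gt0.
apply: (@small_mass _ _ (C - ln (normc (f x)))); first exact: fine_ge0.
move=> L L0; rewrite lerBrDl.
apply: (@Jensen_concentration f _ set0 (cst C%:E) _ _ _ Rf) => //.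
- by rewrite lnK.
- by rewrite integral_cst//= muX mule1.
- move=> w Xw _; have [[_ wy]|nA] := pselect ((X `&` open_disc y r) w).
    by rewrite (hr w wy Xw) normc0 le0_lneNy// addNye leNye.
  rewrite indicE memNset// mulr0 adde0; apply: le_trans (ltW (lne_sublinear _)) _ => //.
  by rewrite lee_fin hC.
Qed.

Lemma trivial_of_null : (forall r : R, 0 < r -> mu (X `&` [set w | r <= normc (w - x)]) = 0%E) ->
  trivial_measure x mu.
Proof.
move=> H.
pose F (n : nat) : set (borelC R) := ~` X `|` (X `&` [set w | n.+1%:R^-1 <= normc (w - x)]).
have mge (r : R) : measurable ([set w | r <= normc (w - x)] : set (borelC R)).
  by apply: closed_borel; exact: closed_normcB_ge.
have mF n : measurable (F n).
  by apply: measurableU; [exact: measurableC | apply: measurableI].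
have F0 n : mu (F n) = 0%E.
  have muXC : mu (~` (X : set (borelC R))) = 0%E by rewrite probability_setC// muX subee.
  apply: null_set_setU => //; [exact: measurableC | exact: measurableI | ].
  by apply: H; rewrite invr_gt0.
have U0 : mu (\bigcup_n F n) = 0%E.
  apply/eqP; rewrite eq_le measure_ge0 andbT.
  apply: le_trans (measure_sigma_subadditive _ _ _ _) _ => //.
    exact: bigcupT_measurable.
  by rewrite eseries0 // => n _ _; exact: F0.
have cov w : w != x -> (\bigcup_n F n) w.
  move=> wx; have d0 : 0 < normc (w - x).
    by rewrite normcB_gt0.
  have [n hn] : exists n : nat, n.+1%:R^-1 <= normc (w - x).
    exists (Num.truncn (normc (w - x))^-1); rewrite invf_ple ?posrE//.
    exact/ltW/truncnS_gt.
  by exists n => //; have [Xw|nXw] := pselect (X w); [right|left].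
have null (A : set (borelC R)) : measurable A -> ~ A x -> mu A = 0%E.
  move=> mA nAx.
  have sub : A `<=` \bigcup_n F n.
    by move=> w Aw; apply: cov; apply/eqP => wx; apply: nAx; rewrite -wx.
  exact: (subset_measure0 mA (bigcupT_measurable _ mF) sub U0).
move=> A mA; rewrite diracE; have [Ax|nAx] := pselect (A x).
  rewrite mem_set//; have := null (~` A) (measurableC mA) (fun h => h Ax).
  by rewrite probability_setC// => /eqP; rewrite sube_eq ?add0e ?fin_num_measure// => /eqP <-.
by rewrite memNset// null.
Qed.
End Jensen.

(** * Jensen measures carried by a thin compact set *)

Section Thin.
Variable R : realType.

Lemma lne_le_expR (y b : R) : 0 <= y -> y <= expR b -> (lne y%:E <= b%:E)%E.
Proof.
move=> y0 yb; apply: le_trans (_ : lne (expR b)%:E <= _)%E.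
  by rewrite lee_lne ?in_itv /= ?lee_fin ?y0 ?expR_ge0 ?leey.
by rewrite lne_EFin ?expR_gt0// expRK.
Qed.

(** The number n counts the dyadic radii del / 2^k larger than t; it is
    comparable to log^+ (del / t). *)
Lemma dyadic_count (del t : R) : 0 < del -> 0 < t ->
  exists2 n : nat, del / 2 ^+ n <= t & forall k, (k < n)%N -> t < del / 2 ^+ k.
Proof.
move=> del0 t0.
have q1 : (1 / 2 : R) < 1 by lra.
have [||m hm] := @geometric_tail_lt R (1 / 2) (t / del) _ q1; [by lra | by rewrite divr_gt0|].
have ex : exists n, del / 2 ^+ n <= t.
  exists m; move: hm; rewrite expr_div_n expr1n ltr_pdivlMr// => /ltW.
  by rewrite mul1r mulrC.
case: (ex_minnP ex) => n hn minn; exists n => // k kn.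
by rewrite ltNge; apply/negP => /minn; rewrite leqNgt kn.
Qed.

Variables (X K : set R[i]) (x : R[i]) (mu : probability (borelC R) R).
Hypothesis cX : compact X.
Hypothesis Jmu : Jensen_measure X x mu.
Hypothesis cK : compact K.
Hypothesis K1 : K `<=` open_disc 0 1.
Hypothesis K0 : K° = set0.
Hypothesis connK : connected (~` K).
Hypothesis Kx : K x.
Hypothesis muXK : mu (X `\` K) = 0%E.

Let s (w : borelC R) : R := normc (w - x).

Let ms : measurable_fun setT s.
Proof.
apply: (@measurable_within_closed R setT (fun w => normc (w - x))); first exact: closedT.
by apply: continuous_subspaceT; exact: continuous_normcB.
Qed.

Let mshell (del r : R) k : measurable (shell s del k r).
Proof.
have m1 : measurable_fun setT (fun w : borelC R => `|s w - r|).
  by apply: measurableT_comp => //; apply: measurable_funB.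
have -> : shell s del k r = (fun w => `|s w - r|) @^-1` `]-oo, (2 * del / 2 ^+ k)[%classic.
  by apply/seteqP; split=> z /=; rewrite /shell /= in_itv.
by rewrite -[X in measurable X]setTI; exact: m1.
Qed.

(** Since x is not interior to K, the complement of K comes closer to x than r;
    it also contains x + 3, because K lies in the unit disc. *)
Lemma exists_center (r : R) : 0 < r -> r <= 1 -> exists2 zeta, ~ K zeta & normc (zeta - x) = r.
Proof.
move=> r0 r1.
have [a nKa ar] : exists2 a, ~ K a & normc (a - x) < r.
  apply: contrapT => no; have : K° x.
    apply/nbhs_complexP; exists r => // a ar; apply: contrapT => nKa; apply: no.
    by exists a.
  by rewrite K0.
have n3 : normc (3 : R[i]) = 3.
  have -> : 3 = (3 : R)%:C :> R[i] by rewrite rmorph_nat.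
  by rewrite normcR ger0_norm.
have nKb : ~ K (x + 3).
  move=> /K1; rewrite /open_disc /= subr0 => h1.
  have h2 : normc x < 1 by have := K1 Kx; rewrite /open_disc /= subr0.
  have := le_normcD (x + 3) (- x); rewrite normcN addrAC subrr add0r n3.
  by lra.
apply: (circle_meets connK nKa ar nKb).
by rewrite addrAC subrr add0r n3; lra.
Qed.

(** Jensen's inequality for f = r p, where p approximates 1 / (z - zeta) on K:
    |f(x)| >= 1/2, |f(w)| <= e^(1 + n) for some n such that w lies in n of the
    shells about the circle through zeta, and |f| <= e^(-L) at distance at
    least rho from x, once the radius is small compared to rho e^(-L).  Hence
    log (1/2) + L mu(A) <= 1 + 9, for every L. *)
Lemma Jensen_thin (rho : R) : 0 < rho -> mu (X `&` [set w | rho <= normc (w - x)]) = 0%E.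
Proof.
move=> rho0; set A : set (borelC R) := X `&` _.
have mX : measurable (X : set (borelC R)) by exact: compact_borel.
have mA : measurable A.
  by apply: measurableI => //; apply: closed_borel; exact: closed_normcB_ge.
apply: measure_fine_eq0 => //; apply: (@small_mass _ _ (10 - ln (1 / 2))); first exact: fine_ge0.
move=> L L0.
have eL : 1 <= expR L by rewrite -expR0 ler_expR.
(* Small enough for (2 del) / (rho - 2 del) <= (2/3) e^(-L); the minimum with 1 keeps r below 1. *)
pose del := Num.min rho 1 / (2 + 3 * expR L).
have den0 : 0 < 2 + 3 * expR L by lra.
have del0 : 0 < del by rewrite divr_gt0// lt_min rho0 ltr01.
have delM : del * (2 + 3 * expR L) = Num.min rho 1 by rewrite divfK// lt0r_neq0.
have delrho : del * (2 + 3 * expR L) <= rho by rewrite delM ge_min lexx.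
have del1 : del * (2 + 3 * expR L) <= 1 by rewrite delM ge_min lexx orbT.
have del5 : 5 * del <= 1 by nra.
have [r /andP[delr r2del] Sr] := select_radius mu ms del0.
have r0 : 0 < r by lra.
have r1 : r <= 1 by lra.
have [zeta nKz zr] := exists_center r0 r1.
have inv := Runge_poly_invertible cK K1 connK nKz.
have [|p hp] := inv (1 / 2); first by lra.
rewrite lerBrDr addrC.
pose f z := (r%:C *: p).[z].
pose S (w : borelC R) : \bar R := (\sum_(0 <= k <oo) (\1_(shell s del k r) w)%:E)%E.
have S0 w : (0 <= S w)%E by apply: nneseries_ge0 => k _ _; rewrite lee_fin.
have mS D : measurable_fun (D : set (borelC R)) S.
  apply: ge0_emeasurable_sum => [k z _ _|k _]; first by rewrite lee_fin.
  rewrite -[fun _ => _]/(EFin \o \1_(shell s del k r)).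
  by apply/measurable_EFinP; exact: measurable_indic.
have nf z : normc (f z) = r * normc p.[z].
  by rewrite /f hornerZ normcM normcR gtr0_norm.
have pK w : K w -> 1 / 2 <= normc p.[w] * normc (w - zeta) <= 3 / 2.
  move=> Kw; rewrite -normcM; have := hp w Kw; set q := p.[w] * _ => hq.
  have := le_normcD (q - 1) 1; rewrite subrK normc1.
  have := le_normcD (1 - q) q; rewrite subrK normc1 normc_distC.
  by move=> h1 h2; apply/andP; split; lra.
apply: (@Jensen_concentration R X x mu cX Jmu f A (X `\` K) (fun w => 1 + S w)%E _ _ 10) => //.
- exact: R_poly.
- rewrite lnK ?posrE; last by lra.
  by rewrite nf; have := pK x Kx; rewrite (normc_distC x) zr => /andP[+ _]; lra.
- by move=> w [].
- by apply: measurableD => //; exact: compact_borel.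
- by apply: emeasurable_funD.
- by move=> w _; rewrite adde_ge0.
- rewrite ge0_integralD//.
  rewrite (_ : 10%:E = 1%:E + 9%:E)%E; last by rewrite -EFinD; congr EFin; lra.
  apply: leeD.
    by rewrite integral_cst// mul1e probability_le1.
  apply: le_trans Sr; apply: ge0_subset_integral => //.
move=> w Xw nXK.
have Kw : K w by apply: contrapT => nKw; apply: nXK.
have [_ pw] := andP (pK w Kw); set t := normc (w - zeta) in pw.
have t0 : 0 < t.
  by rewrite normcB_gt0; apply/eqP => wz; apply: nKz; rewrite -wz.
have [[_ /= Aw]|nA] := pselect (A w).
  rewrite indicE mem_set// mulr1.
  apply: le_trans (_ : 0 <= _)%E; last by rewrite adde_ge0.
  have tL : 3 * del * expR L <= t.
    have := le_normcD (w - zeta) (zeta - x); rewrite addrA subrK zr -/t.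
    by lra.
  have := @lne_le_expR (normc (f w)) (- L) (normc_ge0 _) _.
  have -> : (lne (normc (f w))%:E + L%:E <= 0)%E = (lne (normc (f w))%:E <= (- L)%:E)%E.
    by rewrite EFinN -leeBrDr// sub0e.
  apply; rewrite nf expRN -[leRHS]mul1r ler_pdivlMr ?expR_gt0//.
  have q0 := normc_ge0 p.[w]; set q := normc p.[w] in pw q0 *.
  have h1 : 0 <= q * (t - 3 * del * expR L) by rewrite mulr_ge0// subr_ge0.
  have h2 : 0 <= (2 * del - r) * (q * expR L).
    by rewrite mulr_ge0 ?subr_ge0// mulr_ge0// expR_ge0.
  by lra.
rewrite indicE memNset// mulr0 adde0.
have d20 : 0 < 2 * del by lra.
have [n tn hn] := dyadic_count d20 t0.
apply: le_trans (_ : (1 + n%:R)%:E <= _)%E.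
  apply: lne_le_expR; first exact: normc_ge0.
  rewrite nf expRD; apply: le_trans (_ : 3 / 2 * 2 ^+ n <= _).
    have := exprn_gt0 n (ltr0n R 2); set P := 2 ^+ n in tn * => P0.
    rewrite ler_pdivrMr// in tn.
    have q0 := normc_ge0 p.[w]; set q := normc p.[w] in pw q0 *.
    have h1 : 0 <= q * (t * P - 2 * del) by rewrite mulr_ge0// subr_ge0.
    have h2 : 0 <= (2 * del - r) * q by rewrite mulr_ge0// subr_ge0.
    have h3 : 0 <= P * (3 / 2 - q * t) by rewrite mulr_ge0 ?(ltW P0)// subr_ge0.
    by lra.
  have e2 : 2 <= expR 1 :> R by have := expR_ge1Dx (1 : R); lra.
  apply: ler_pM; [by lra | by rewrite exprn_ge0 | by lra |].
  by rewrite -[n%:R]mulr1 expRM_natl lerXn2r ?nnegrE ?expR_ge0.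
rewrite EFinD leeD2l//.
apply: le_trans (nneseries_lim_ge n _) => //.
rewrite (eq_big_nat _ _ (F2 := fun=> 1%:E)); last first.
  move=> k /andP[_ kn]; rewrite indicE mem_set//.
  rewrite /shell /= /s -zr; apply: le_lt_trans (ler_dist_normc _ _) _.
  by rewrite (_ : w - x - (zeta - x) = w - zeta) ?hn//; ring.
by rewrite sumEFin lee_fin big_mkord sumr_const card_ord.
Qed.
End Thin.

(** * Combining the two arguments *)

Lemma segment_sub (R : realType) (I : set R[i]) (x y : R[i]) :
  line_segment I -> I x -> I y -> segment x y `<=` I.
Proof.
move=> [a [b [_ ->]]] [s /= /andP[s0 s1] <-] [t /= /andP[t0 t1] <-] _ [u /= /andP[u0 u1] <-].
exists (s + u * (t - s)); first by rewrite /=; apply/andP; split; nra.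
by rewrite !rmorphD /= !rmorphM /= rmorphB /=; ring.
Qed.

Lemma J_sub_M_segment (R : realType) (X K : set R[i]) (x y : R[i]) :
  K `<=` X -> x <> y -> segment x y `<=` K ->
  (forall J, line_segment J -> J `<=` K -> forall f, R_ X f ->
     infinitely_differentiable_on J f /\ quasianalytic_sum J f = +oo%E) ->
  J_ X x `<=` M_ X y.
Proof.
move=> KX xy sK Xseg f [Rf f0]; split=> //.
have [|df qf] := Xseg (segment x y) _ sK f Rf; first by exists x, y.
apply: (quasianalytic_unique_continuation xy df qf).
move/nbhs_complexP: f0 => [d d0 hd]; apply/nbhs_complexP; exists d => // w wx sw.
exact/hd/KX/sK.
Qed.

(** Regularity of mu reduces this to compact subsets of X outside K. *)
Lemma null_off_K (R : realType) (X K : set R[i]) (x : R[i]) (mu : probability (borelC R) R) :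
  compact X -> compact K -> Jensen_measure X x mu ->
  (forall y, (X `\` K) y -> ~ (J_ X y `<=` M_ X x)) -> mu (X `\` K) = 0%E.
Proof.
move=> cX cK Jmu nJ.
have mXK : measurable (X `\` K : set (borelC R)).
  by apply: measurableD; exact: compact_borel.
have [[_ reg _] _] := Jmu; have [_ ->] := reg _ mXK.
apply/eqP; rewrite eq_le; apply/andP; split; last first.
  apply: ereal_sup_ubound; exists set0; last exact: measure0.
  by split; [exact: compact0 | exact: sub0set].
apply: ub_ereal_sup => _ [L [cL LXK] <-].
have XL : X `&` L = L by apply: setIidr => w /LXK [].
have H y : L y -> exists2 r : R, 0 < r & mu (X `&` open_disc y r) = 0%E.
  by move=> Ly; apply: (Jensen_support cX Jmu); apply: nJ; exact: LXK.
have := compact_null cL (compact_borel cX) H; rewrite XL => L0.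
by rewrite le_eqVlt; apply/orP; left; apply/eqP; exact: L0.
Qed.

Lemma no_nontrivial_Jensen (R : realType) (K X : set R[i]) :
  compact K -> K `<=` open_disc 0 1 -> K° = set0 -> connected (~` K) ->
  compact X -> K `<=` X ->
  (forall x, (X `\` K) x -> point_of_continuity X x /\ R_point X x) ->
  no_nontrivial_Jensen_measures X.
Proof.
move=> cK K1 K0 connK cX KX pts x mu Xx Jmu; apply: (trivial_of_null cX Jmu) => rho rho0.
have [Kx|nKx] := pselect (K x).
  suff muXK : mu (X `\` K) = 0%E by exact: (Jensen_thin cX Jmu cK K1 K0 connK Kx muXK rho0).
  apply: (null_off_K cX cK Jmu) => y [Xy nKy].
  have [_ [_ Ry]] := pts y (conj Xy nKy).
  by apply: Ry => // xy; apply: nKy; rewrite -xy.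
have [[_ pc] _] := pts x (conj Xx nKx).
rewrite -[X in X `&` _]setIid -setIA; apply: compact_null => //.
- apply: (subclosed_compact _ cX); last exact: subIsetl.
  apply: closedI; last exact: closed_normcB_ge.
  by apply: compact_closed => //; exact: norm_hausdorff.
- exact: compact_borel.
move=> y [Xy /= yx]; apply: (Jensen_support cX Jmu); apply: pc => // yx'.
by move: yx; rewrite yx' subrr normc0 leNgt rho0.
Qed.

Unset Implicit Arguments.

Theorem corollary4p6 (R : realType) (K X I : set R[i])
  (K_compact : compact K) (K_disc : K `<=` open_disc 0 1)
  (K_interior : K° = set0) (K_compl : connected (~` K))
  (K_segment : exists J, line_segment J /\ J `<=` K)
  (X_cheese : swiss_cheese_set X) (KX : K `<=` X)
  (X_points : forall x, (X `\` K) x ->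
     point_of_continuity X x /\ R_point X x)
  (X_segments : forall J, line_segment J -> J `<=` K ->
     forall f, R_ X f ->
       infinitely_differentiable_on J f /\ quasianalytic_sum J f = +oo%E)
  (I_segment : line_segment I) (IK : I `<=` K) :
  [/\ no_nontrivial_Jensen_measures X,
      forall x, I x -> ~ R_point X x /\ ~ point_of_continuity X x
    & ~ regular_R X].
Proof.
have cX : compact X by case: X_cheese => -[].
have JM x y : I x -> I y -> x <> y -> J_ X x `<=` M_ X y.
  move=> Ix Iy xy; apply: (J_sub_M_segment KX xy) => //.
  exact: subset_trans (segment_sub I_segment Ix Iy) IK.
have IX w : I w -> X w by move=> Iw; exact/KX/IK.
have [a [b [ab Iab]]] := I_segment.
have Ia : I a by rewrite Iab; exact: segment_left.
have Ib : I b by rewrite Iab; exact: segment_right.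
split.
- exact: (no_nontrivial_Jensen K_compact).
- move=> x Ix; have [y Iy yx] : exists2 y, I y & y <> x.
    by have [->|/eqP ax] := eqVneq x a; [exists b => // /esym | exists a => // /esym].
  split=> -[_ no]; apply: (no y) => //; try exact: IX; apply: JM => //.
  by move=> /esym.
- move=> reg; have d0 : 0 < normc (b - a).
    by rewrite normcB_gt0; apply/eqP => /esym.
  pose F := X `\` [set w | normc (w - a) > normc (b - a) / 2].
  have [|||f [Rf fb f0]] := reg F b.
  + apply: closedI; last exact/open_closedC/open_normcB_gt.
    by apply: compact_closed => //; exact: norm_hausdorff.
  + exact: subIsetl.
  + by split; [exact: IX | case=> _; apply; rewrite /=; lra].
  have [_] : M_ X b f.
    apply: (JM a b) => //; split=> //; apply/nbhs_complexP.
    exists (normc (b - a) / 2); first by rewrite divr_gt0.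
    move=> w wa Xw; apply: f0; exists w => //; split=> //= wa'.
    by move: wa; rewrite ltNge ltW.
  by rewrite fb => /eqP; rewrite oner_eq0.
Qed.
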